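(* Let $T\subset\mathbb{R}^d$ ($d\in\{2,3\}$) be a nondegenerate simplex and $k\ge1$. The set of linear functionals $\Phi(T)$ is unisolvent on $\Sigma_k(T)$ (so $(T,\Sigma_k(T),\Phi(T))$ is a finite element in the sense of Ciarlet: the only $\tau\in\Sigma_k(T)$ with $\phi(\tau)=0$ for all $\phi\in\Phi(T)$ is $\tau=0$, and the number of functionals equals $\dim\Sigma_k(T)$), and $$\dim\Sigma_k(T)=\begin{cases}\frac32(k+1)(k+2)-3,& d=2,\\ \frac86(k+1)(k+2)(k+3)-8(k+1),& d=3.\end{cases}$$
   Context: $\mathbb{D}=\{M\in\mathbb{R}^{d\times d}:\operatorname{tr}M=0\}$. For a facet $F$ with unit normal $n$ and a matrix field $\tau$, $\tau_{nt}=\tau n-(n^T\tau n)n$, a tangential vector field on $F$ identified with an $\mathbb{R}^{d-1}$-valued function. $\Sigma_k(T)=\{\tau\in\mathbb{P}^k(T,\mathbb{D}):\tau_{nt}|_F\in\mathbb{P}^{k-1}(F,\mathbb{R}^{d-1})\text{ for all facets }F\text{ of }T\}$ and $\mathcal{B}_k(T)=\{\tau\in\Sigma_k(T):\tau_{nt}=0\text{ on }\partial T\}$. Let $\hat T$ be the unit reference simplex, $\phi_T:\hat T\to T$ an affine bijection and $F_T=\phi_T'$ its (constant) Jacobian. The degrees of freedom are $\Phi(T)=\Phi^T\cup\bigcup_{F}\Phi^F$, where for each facet $F$ of $T$, $\Phi^F=\{\tau\mapsto\int_F\tau_{nt}\cdot r\,ds:\ r\in\mathbb{P}^{k-1}(F,\mathbb{R}^{d-1})\}$,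 and $\Phi^T=\{\tau\mapsto\int_T\tau:F_T(\hat\eta\circ\phi_T^{-1})F_T^{-1}\,dx:\ \hat\eta\in\mathcal{B}_k(\hat T)\}$. *)

(* Defs.v *)
From HB Require Import structures.
From mathcomp Require Import all_boot all_order all_algebra.
From mathcomp Require Import all_classical all_reals all_analysis.
Set Implicit Arguments. Unset Strict Implicit. Unset Printing Implicit Defensive.
Import Order.TTheory GRing.Theory Num.Theory.
Import numFieldNormedType.Exports.
Local Open Scope ring_scope.

Section Defs.
Variable R : realType.

Definition poly_fun (m k : nat) (f : 'cV[R]_m -> R) : Prop :=
  exists c : {ffun 'I_m -> 'I_k.+1} -> R,
    forall x : 'cV[R]_m,
      f x = \sum_(a : {ffun 'I_m -> 'I_k.+1} | (\sum_(i < m) (a i : nat) <= k)%N)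
              c a * \prod_(i < m) x i ord0 ^+ a i.

Definition poly_mx (m p q k : nat) (f : 'cV[R]_m -> 'M[R]_(p, q)) : Prop :=
  forall a b, poly_fun k (fun x => f x a b).

Definition has_dim (m p q : nat) (S : ('cV[R]_m -> 'M[R]_(p, q)) -> Prop) (N : nat)
  : Prop :=
  exists b : 'I_N -> 'cV[R]_m -> 'M[R]_(p, q),
    [/\ (forall i, S (b i)),
        (forall c : 'I_N -> R, (forall x, \sum_(i < N) c i *: b i x = 0) ->
            forall i, c i = 0) &
        (forall f, S f -> exists c : 'I_N -> R,
            forall x, f x = \sum_(i < N) c i *: b i x)].

Definition dotv (m : nat) (a b : 'cV[R]_m) : R := \sum_(i < m) a i ord0 * b i ord0.
Definition frob (m : nat) (A B : 'M[R]_m) : R := \sum_(i < m) \sum_(j < m) A i j * B i j.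

Definition tnt (d : nat) (n : 'cV[R]_d) (A : 'M[R]_d) : 'cV[R]_d :=
  A *m n - (dotv n (A *m n)) *: n.

(* simplex_int m t f = integral of f over {x in R^m | x >= 0, sum x <= t},
   as an iterated Lebesgue integral *)
Fixpoint simplex_int (m : nat) : R -> ('cV[R]_m -> R) -> R :=
  match m with
  | 0 => fun _ f => f 0
  | m'.+1 => fun t f =>
      Rintegral (@lebesgue_measure R) `[0, t]%classic
        (fun x : R => simplex_int (t - x)
                        (fun y : 'cV[R]_m' => f (col_mx (x%:M : 'M[R]_1) y)))
  end.

Definition in_ref_simplex (m : nat) (s : 'cV[R]_m) : Prop :=
  (forall i, 0 <= s i ord0) /\ \sum_(i < m) s i ord0 <= 1.

(* a d-simplex is given by its vertex tuple v_0, ..., v_d *)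
Definition jacT (d : nat) (v : 'I_d.+1 -> 'cV[R]_d) : 'M[R]_d :=
  \matrix_(a < d, i < d) (v (lift ord0 i) - v ord0) a ord0.

Definition phiT (d : nat) (v : 'I_d.+1 -> 'cV[R]_d) (xh : 'cV[R]_d) : 'cV[R]_d :=
  v ord0 + jacT v *m xh.

Definition nondegen_simplex (d : nat) (v : 'I_d.+1 -> 'cV[R]_d) : Prop :=
  jacT v \in unitmx.

Definition ref_vert (d : nat) (i : 'I_d.+1) : 'cV[R]_d :=
  \col_(a < d) (if (i : nat) == a.+1 then 1 else 0).

Definition int_T (d : nat) (v : 'I_d.+1 -> 'cV[R]_d) (g : 'cV[R]_d -> R) : R :=
  `|\det (jacT v)| * @simplex_int d 1 (fun xh => g (phiT v xh)).

(* facet F_j of T = the facet opposite vertex j; its vertices, in order *)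
Definition fvert (d : nat) (v : 'I_d.+1 -> 'cV[R]_d) (j : 'I_d.+1) (i : nat)
  : 'cV[R]_d :=
  oapp (fun o : 'I_d => v (lift j o)) 0 (insub i).

Definition jacF (d : nat) (v : 'I_d.+1 -> 'cV[R]_d) (j : 'I_d.+1) : 'M[R]_(d, d.-1) :=
  \matrix_(a < d, i < d.-1) (fvert v j i.+1 - fvert v j 0) a ord0.

Definition phiF (d : nat) (v : 'I_d.+1 -> 'cV[R]_d) (j : 'I_d.+1) (s : 'cV[R]_d.-1)
  : 'cV[R]_d :=
  fvert v j 0 + jacF v j *m s.

(* surface integral over the facet via the parametrisation
   (Gram determinant factor times the integral over the reference facet) *)
Definition int_F (d : nat) (v : 'I_d.+1 -> 'cV[R]_d) (j : 'I_d.+1)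
  (g : 'cV[R]_d.-1 -> R) : R :=
  Num.sqrt (\det ((jacF v j)^T *m jacF v j)) * @simplex_int d.-1 1 g.

Definition unit_normal (d : nat) (v : 'I_d.+1 -> 'cV[R]_d) (j : 'I_d.+1)
  (n : 'cV[R]_d) : Prop :=
  dotv n n = 1 /\ forall i i' : 'I_d, dotv n (v (lift j i) - v (lift j i')) = 0.

Definition Sigma (d k : nat) (v : 'I_d.+1 -> 'cV[R]_d) (tau : 'cV[R]_d -> 'M[R]_d)
  : Prop :=
  [/\ poly_mx k tau,
      (forall x, \tr (tau x) = 0) &
      (forall j n, unit_normal v j n ->
         poly_mx k.-1 (fun s : 'cV[R]_d.-1 => tnt n (tau (phiF v j s))))].

Definition Bk (d k : nat) (v : 'I_d.+1 -> 'cV[R]_d) (tau : 'cV[R]_d -> 'M[R]_d)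
  : Prop :=
  Sigma k v tau /\
  forall j n, unit_normal v j n ->
    forall s, in_ref_simplex s -> tnt n (tau (phiF v j s)) = 0.

(* facet dof: tau |-> int_F tau_nt . r ds, with the tangential test field r on F
   written as  r(phi_F s) = jacF * rh(s),  rh in P^{k-1}(R^{d-1}, R^{d-1}) *)
Definition dof_F (d : nat) (v : 'I_d.+1 -> 'cV[R]_d) (j : 'I_d.+1) (n : 'cV[R]_d)
  (rh : 'cV[R]_d.-1 -> 'cV[R]_d.-1) (tau : 'cV[R]_d -> 'M[R]_d) : R :=
  int_F v j (fun s => dotv (tnt n (tau (phiF v j s))) (jacF v j *m rh s)).

Definition dof_T (d : nat) (v : 'I_d.+1 -> 'cV[R]_d) (etah : 'cV[R]_d -> 'M[R]_d)
  (tau : 'cV[R]_d -> 'M[R]_d) : R :=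
  int_T v (fun x => frob (tau x)
     (jacT v *m etah (invmx (jacT v) *m (x - v ord0)) *m invmx (jacT v))).

End Defs.

(* Main.v *)
Require Import Defs.
From HB Require Import structures.
From mathcomp Require Import all_boot all_order all_algebra.
From mathcomp Require Import all_classical all_reals all_analysis.
From mathcomp Require Import ring lra zify.
Set Implicit Arguments. Unset Strict Implicit. Unset Printing Implicit Defensive.
Import Order.TTheory GRing.Theory Num.Theory.
Import numFieldNormedType.Exports.
Local Open Scope ring_scope.

(** The gradients of the barycentric coordinates of a nondegenerate d-simplex
    are normal to its facets. A constant trace-free matrix M with t^T M n = 0 for
    every facet normal n and every t tangent to that facet has all these
    gradients as eigenvectors. As the gradients span and satisfy only the
    relation "their sum is zero", all eigenvalues agree and M = 0. Since
    (d + 1)(d - 1) = d^2 - 1, the components t^T M n (d - 1 per facet) are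
    therefore linear coordinates on trace-free matrices. In these coordinates
    Sigma_k is a product of (d + 1)(d - 1) scalar spaces
    {g in P^k(R^d) : g|_F in P^(k-1)(F)}, and B_k is the product of the spaces
    {g in P^k(R^d) : g|_F = 0}; both dimensions follow from the splitting
    g = g|_F + lambda h with h in P^(k-1)(R^d), where lambda is the barycentric
    coordinate vanishing on F.

    For unisolvence, testing with tau_nt itself shows that tau_nt vanishes on all
    facets; then eta(x) = F_T^T tau(phi_T x) F_T^(-T) lies in B_k of the reference
    simplex, and testing with it yields a multiple of the integral of |eta|^2. *)

(** * Dimension counts through explicit finite bases *)

Section Dimension.
Variable R : realType.

(** The index type is an arbitrary finite type, so that bases of direct sums and of families are
    indexed directly by sum and product types; [has_dim_dimis] renumbers them by ordinals. *)
Definition dimis (V : lmodType R) (S : V -> Prop) (N : nat) : Prop :=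
  exists (I : finType) (b : I -> V),
    [/\ #|I| = N,
        forall i, S (b i),
        forall c : I -> R, \sum_i c i *: b i = 0 -> forall i, c i = 0 &
        forall f, S f -> exists c : I -> R, f = \sum_i c i *: b i].

Definition lin_subspace (V : lmodType R) (S : V -> Prop) : Prop :=
  S 0 /\ forall a f g, S f -> S g -> S (a *: f + g).

Lemma lin_subspace_sum (V : lmodType R) (S : V -> Prop) (I : finType)
    (c : I -> R) (b : I -> V) :
  lin_subspace S -> (forall i, S (b i)) -> S (\sum_i c i *: b i).
Proof.
move=> [S0 SD] Sb; apply: big_ind => // [x y Sx Sy|i _].
  by rewrite -(scale1r x); exact: SD.
by rewrite -(addr0 (_ *: _)); exact: SD.
Qed.

Lemma linear_combination (U V : lmodType R) (phi : U -> V) (I : finType)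
    (c : I -> R) (b : I -> U) :
  linear phi -> phi (\sum_i c i *: b i) = \sum_i c i *: phi (b i).
Proof.
move=> lphi.
have phiD x y : phi (x + y) = phi x + phi y by have := lphi 1 x y; rewrite !scale1r.
have phi0 : phi 0 = 0 by apply: (addrI (phi 0)); rewrite -phiD !addr0.
have phiZ a x : phi (a *: x) = a *: phi x by rewrite -(addr0 (a *: x)) lphi phi0 addr0.
by rewrite (big_morph _ phiD phi0); apply: eq_bigr => i _; rewrite phiZ.
Qed.

Lemma dimis_ext (V : lmodType R) (S S' : V -> Prop) N :
  (forall f, S f <-> S' f) -> dimis S N -> dimis S' N.
Proof.
move=> SS [I [b [cI Sb fb gb]]]; exists I, b; split=> //.
- by move=> i; exact/SS.
- by move=> f /SS; exact: gb.
Qed.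

Lemma dimis0 (V : lmodType R) : dimis (fun f : V => f = 0) 0.
Proof.
exists 'I_0, (fun=> 0); split=> //; first by rewrite card_ord.
  by move=> c _ [].
by move=> f ->; exists (fun=> 0); rewrite big_ord0.
Qed.

(** The images of the two bases, side by side over the sum type, form a basis: joint injectivity
    gives independence, joint surjectivity gives generation. *)
Lemma dimis_direct_sum (U1 U2 V : lmodType R) (S1 : U1 -> Prop) (S2 : U2 -> Prop)
    (S : V -> Prop) (phi1 : U1 -> V) (phi2 : U2 -> V) (N1 N2 : nat) :
  linear phi1 -> linear phi2 -> lin_subspace S1 -> lin_subspace S2 ->
  (forall f, S1 f -> S (phi1 f)) -> (forall f, S2 f -> S (phi2 f)) ->
  (forall f g, S1 f -> S2 g -> phi1 f + phi2 g = 0 -> f = 0 /\ g = 0) ->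
  (forall h, S h -> exists f g, [/\ S1 f, S2 g & h = phi1 f + phi2 g]) ->
  dimis S1 N1 -> dimis S2 N2 -> dimis S (N1 + N2).
Proof.
move=> l1 l2 s1 s2 S1S S2S inj surj [I [b [cI Sb fb gb]]] [J [e [cJ Se fe ge]]].
pose w k := match k with inl i => phi1 (b i) | inr j => phi2 (e j) end.
exists (I + J)%type, w.
have sumE (c : I + J -> R) : \sum_k c k *: w k = phi1 (\sum_i c (inl i) *: b i) + phi2 (\sum_j c (inr j) *: e j).
  by rewrite big_sumType /= (linear_combination _ _ l1) (linear_combination _ _ l2).
split.
- by rewrite card_sum cI cJ.
- by case=> [i|j]; [exact/S1S|exact/S2S].
- move=> c; rewrite sumE => /inj[|| /fb c1 /fe c2]; try exact: lin_subspace_sum.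
  by case=> [i|j].
- move=> h /surj[f [g [/gb[c1 ->] /ge[c2 ->] ->]]].
  by exists (fun k => match k with inl i => c1 i | inr j => c2 j end); rewrite sumE.
Qed.

Lemma dimis_iso (U V : lmodType R) (S : U -> Prop) (S' : V -> Prop)
    (phi : U -> V) (N : nat) :
  linear phi -> lin_subspace S ->
  (forall f, S f -> S' (phi f)) -> (forall f, S f -> phi f = 0 -> f = 0) ->
  (forall h, S' h -> exists2 f, S f & h = phi f) ->
  dimis S N -> dimis S' N.
Proof.
move=> l s SS inj surj [I [b [cI Sb fb gb]]]; exists I, (phi \o b); split => //=.
- by move=> i; exact/SS.
- by move=> c; rewrite -(linear_combination _ _ l) => /(inj _ (lin_subspace_sum _ s Sb)); exact: fb.
- by move=> h /surj[f /gb[c ->] ->]; exists c; rewrite (linear_combination _ _ l).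
Qed.

(** The basis element at [(j, i)] is the family with [b i] in slot [j] and zero elsewhere. *)
Lemma dimis_family (V : lmodType R) (S : V -> Prop) (N : nat) (J : finType) :
  lin_subspace S -> dimis S N ->
  dimis (fun F : J -> V => forall j, S (F j)) (#|J| * N).
Proof.
move=> [S0 SD] [I [b [cI Sb fb gb]]].
pose e (u : J * I) (j : J) := if j == u.1 then b u.2 else 0.
have sumE (c : J * I -> R) j : (\sum_u c u *: e u) j = \sum_i c (j, i) *: b i.
  pose h j' i : V := if j == j' then c (j', i) *: b i else 0.
  transitivity (\sum_u h u.1 u.2).
    rewrite fct_sumE; apply: eq_bigr => -[j' i] _.
    by rewrite scalrfctE /e /h /=; case: ifP => // _; rewrite scaler0.
  rewrite -(pair_bigA _ h) /= (bigD1 j) //= [X in _ + X]big1 ?addr0.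
    by apply: eq_bigr => i _; rewrite /h eqxx.
  by move=> j' /negPf jj'; apply: big1 => i _; rewrite /h eq_sym jj'.
exists (J * I)%type, e; split.
- by rewrite card_prod cI.
- by move=> u j; rewrite /e; case: ifP.
- by move=> c c0 [j i]; apply: (fb (fun i => c (j, i))); rewrite -sumE c0.
(* Coefficients exist for each [j] separately; choice assembles them into one function. *)
- move=> F /(_ _)/gb/cid SF.
  exists (fun u => sval (SF u.1) u.2); apply/funext => j.
  by rewrite sumE /=; case: (SF j).
Qed.

Lemma has_dim_dimis (m p q N : nat) (S : ('cV[R]_m -> 'M[R]_(p, q)) -> Prop) :
  dimis S N -> has_dim S N.
Proof.
move=> [I [b [cI Sb fb gb]]]; subst N.
exists (b \o enum_val); split => /=.
- by move=> i.
- move=> c c0 i; rewrite -(enum_valK i).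
  apply: (fb (c \o enum_rank)); apply/funext => x.
  rewrite fct_sumE -[RHS](c0 x) (reindex _ (onW_bij _ (enum_val_bij I))) /=.
  by apply: eq_bigr => k _; rewrite enum_valK.
- move=> f /gb[c ->]; exists (c \o enum_val) => x.
  by rewrite fct_sumE (reindex _ (onW_bij _ (enum_val_bij I))).
Qed.
End Dimension.

(** * Polynomial functions of bounded total degree *)

Section Polynomials.
Variable R : realType.

Inductive pdeg (m : nat) : nat -> ('cV[R]_m -> R) -> Prop :=
| pdeg_cst k c : pdeg k (fun=> c)
| pdegD k f g : pdeg k f -> pdeg k g -> pdeg k (fun x => f x + g x)
| pdegX k i f : pdeg k f -> pdeg k.+1 (fun x => x i ord0 * f x).

Lemma pdegS m k (f : 'cV[R]_m -> R) : pdeg k f -> pdeg k.+1 f.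
Proof. by elim=> *; [exact: pdeg_cst|exact: pdegD|exact: pdegX]. Qed.

Lemma pdegW m k l (f : 'cV[R]_m -> R) : (k <= l)%N -> pdeg k f -> pdeg l f.
Proof.
by move=> /subnK <- pf; elim: (l - k)%N => //= n IH; rewrite addSn; exact: pdegS.
Qed.

Lemma pdegZ m k c (f : 'cV[R]_m -> R) : pdeg k f -> pdeg k (fun x => c * f x).
Proof.
elim=> [k' c'|k' f' g' _ pf _ pg|k' i f' _ pf]; first exact: pdeg_cst.
  have -> : (fun x => c * (f' x + g' x)) = (fun x => c * f' x + c * g' x).
    by apply/funext => x; rewrite mulrDr.
  exact: pdegD.
have -> : (fun x : 'cV[R]_m => c * (x i ord0 * f' x)) = (fun x => x i ord0 * (c * f' x)).
  by apply/funext => x; rewrite mulrCA.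
exact: pdegX.
Qed.

Lemma pdeg_linear m k a (f g : 'cV[R]_m -> R) : pdeg k f -> pdeg k g ->
  pdeg k (fun x => a * f x + g x).
Proof. by move=> pf pg; apply: pdegD => //; exact: pdegZ. Qed.

Lemma pdegM m k l (f g : 'cV[R]_m -> R) : pdeg k f -> pdeg l g ->
  pdeg (k + l) (fun x => f x * g x).
Proof.
move=> pf pg; elim: pf => [k' c|k' f' g' _ pf' _ pg'|k' i f' _ pf'].
- by apply: pdegW (pdegZ c pg); rewrite leq_addl.
- have -> : (fun x => (f' x + g' x) * g x) = (fun x => f' x * g x + g' x * g x).
    by apply/funext => x; rewrite mulrDl.
  exact: pdegD.
- have -> : (fun x : 'cV[R]_m => x i ord0 * f' x * g x) = (fun x => x i ord0 * (f' x * g x)).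
    by apply/funext => x; rewrite mulrA.
  exact: pdegX.
Qed.

Lemma pdeg_sum m k (I : Type) (r : seq I) (P : pred I) (F : I -> 'cV[R]_m -> R) :
  (forall i, P i -> pdeg k (F i)) -> pdeg k (fun x => \sum_(i <- r | P i) F i x).
Proof.
move=> pF; elim: r => [|i r IH].
  have -> : (fun x => \sum_(i <- [::] | P i) F i x) = (fun=> 0).
    by apply/funext => x; rewrite big_nil.
  exact: pdeg_cst.
have -> : (fun x => \sum_(i <- i :: r | P i) F i x) =
    (if P i then fun x => F i x + \sum_(i <- r | P i) F i x
     else fun x => \sum_(i <- r | P i) F i x).
  by apply/funext => x; rewrite big_cons; case: ifP.
by case: ifP => // /pF ?; exact: pdegD.
Qed.

Lemma pdeg_monomial m (a : 'I_m -> nat) :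
  pdeg (\sum_(i < m) a i) (fun x => \prod_(i < m) x i ord0 ^+ a i).
Proof.
elim: (index_enum 'I_m) => [|i r IH].
  have -> : (fun x : 'cV[R]_m => \prod_(i <- [::]) x i ord0 ^+ a i) = (fun=> 1).
    by apply/funext => x; rewrite big_nil.
  exact: pdeg_cst.
have -> : (fun x : 'cV[R]_m => \prod_(i <- i :: r) x i ord0 ^+ a i) =
    (fun x => x i ord0 ^+ a i * \prod_(i <- r) x i ord0 ^+ a i).
  by apply/funext => x; rewrite big_cons.
rewrite big_cons; apply: pdegM => //.
elim: (a i) => [|n IHn]; first exact: pdeg_cst.
have -> : (fun x : 'cV[R]_m => x i ord0 ^+ n.+1) = (fun x => x i ord0 * x i ord0 ^+ n).
  by apply/funext => x; rewrite exprS.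
exact: pdegX.
Qed.

Lemma poly_fun_monomial m k (a : 'I_m -> nat) c : (\sum_(i < m) a i <= k)%N ->
  poly_fun k (fun x : 'cV[R]_m => c * \prod_(i < m) x i ord0 ^+ a i).
Proof.
move=> ak; pose a' : {ffun 'I_m -> 'I_k.+1} := [ffun i => inord (a i)].
have a'E i : a' i = a i :> nat.
  rewrite ffunE inordK // ltnS; apply: leq_trans ak.
  by rewrite (bigD1 i) //= leq_addr.
exists (fun b => if b == a' then c else 0) => x.
rewrite (bigD1 a') /=; last by rewrite (eq_bigr a).
rewrite eqxx [X in _ + X]big1 ?addr0; last by move=> b /andP[_ /negPf ->]; rewrite mul0r.
by congr (_ * _); apply: eq_bigr => i _; rewrite a'E.
Qed.

Lemma poly_funD m k (f g : 'cV[R]_m -> R) : poly_fun k f -> poly_fun k g ->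
  poly_fun k (fun x => f x + g x).
Proof.
move=> [c fE] [e gE]; exists (fun a => c a + e a) => x.
by rewrite fE gE -big_split; apply: eq_bigr => a _; rewrite mulrDl.
Qed.

Lemma poly_fun_sum m k (I : Type) (r : seq I) (P : pred I) (F : I -> 'cV[R]_m -> R) :
  (forall i, P i -> poly_fun k (F i)) -> poly_fun k (fun x => \sum_(i <- r | P i) F i x).
Proof.
move=> pF; elim: r => [|i r IH].
  by exists (fun=> 0) => x; rewrite big_nil big1 // => a _; rewrite mul0r.
have -> : (fun x => \sum_(i <- i :: r | P i) F i x) =
    (if P i then fun x => F i x + \sum_(i <- r | P i) F i x
     else fun x => \sum_(i <- r | P i) F i x).
  by apply/funext => x; rewrite big_cons; case: ifP.
by case: ifP => // /pF ?; exact: poly_funD.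
Qed.

Lemma poly_funP m k (f : 'cV[R]_m -> R) : poly_fun k f <-> pdeg k f.
Proof.
split=> [[c fE]|].
  rewrite (funext fE); apply: pdeg_sum => a ak; apply: pdegZ.
  by apply: pdegW ak (pdeg_monomial _).
elim=> [k' c|k' f' g' _ pf _ pg|k' i f' _ [c f'E]]; last 1 first.
- have -> : (fun x : 'cV[R]_m => x i ord0 * f' x) = (fun x =>
      \sum_(a : {ffun 'I_m -> 'I_k'.+1} | (\sum_(i < m) (a i : nat) <= k')%N)
         c a * \prod_(j < m) x j ord0 ^+ (a j + (j == i)%N)).
    apply/funext => x; rewrite f'E mulr_sumr; apply: eq_bigr => a _.
    rewrite mulrCA; congr (_ * _).
    under [RHS]eq_bigr => j _ do rewrite exprD.
    rewrite big_split /= mulrC; congr (_ * _).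
    by rewrite (bigD1 i) //= eqxx expr1 big1 ?mulr1 // => j /negPf ->; rewrite expr0.
  apply: poly_fun_sum => a ak; apply: poly_fun_monomial.
  rewrite big_split /= -[X in (_ <= X)%N]addn1 leq_add //.
  by rewrite (bigD1 i) //= eqxx big1 // => j /negPf ->.
- have -> : (fun=> c) = (fun x : 'cV[R]_m => c * \prod_(i < m) x i ord0 ^+ 0).
    by apply/funext => x; rewrite big1 ?mulr1 // => i _; rewrite expr0.
  by apply: poly_fun_monomial; rewrite big1.
- exact: poly_funD.
Qed.

Lemma pdeg_affine m p k (f : 'cV[R]_m -> R) (b : 'cV[R]_m) (A : 'M[R]_(m, p)) :
  pdeg k f -> pdeg k (fun x => f (b + A *m x)).
Proof.
elim=> [k' c|k' f' g' _ pf _ pg|k' i f' _ pf]; [exact: pdeg_cst|exact: pdegD|].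
have -> : (fun x => (b + A *m x) i ord0 * f' (b + A *m x)) =
  (fun x => b i ord0 * f' (b + A *m x) +
            \sum_(j < p) A i j * (x j ord0 * f' (b + A *m x))).
  apply/funext => x; rewrite !mxE mulrDl mulr_suml; congr (_ + _).
  by apply: eq_bigr => j _; rewrite mulrA.
apply: pdegD; first by apply/pdegS/pdegZ.
by apply: pdeg_sum => j _; apply/pdegZ/pdegX.
Qed.

Lemma pdeg_line m k (f : 'cV[R]_m -> R) (a b : 'cV[R]_m) : pdeg k f ->
  exists p : {poly R}, forall s, f (a + s *: b) = p.[s].
Proof.
elim=> [k' c|k' f' g' _ [p pE] _ [q qE]|k' i f' _ [p pE]].
- by exists c%:P => s; rewrite hornerC.
- by exists (p + q) => s; rewrite pE qE hornerD.
- exists (((a i ord0)%:P + (b i ord0) *: 'X) * p) => s.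
  by rewrite pE !hornerE !mxE; ring.
Qed.

Lemma poly_eq0_itv (p : {poly R}) (e : R) : 0 < e ->
  (forall s, 0 < s < e -> p.[s] = 0) -> p = 0.
Proof.
move=> e0 p0; apply/eqP/negP => /negP pn0.
(* These are [size p] distinct roots, one more than a nonzero [p] allows; the denominators start at
   2 to keep every point strictly below [e]. *)
pose r := [seq e / (i.+2)%:R | i <- iota 0 (size p)].
have : (size r < size p)%N.
  apply: max_poly_roots => //.
    apply/allP => _ /mapP[i _ ->]; apply/eqP/p0.
    rewrite divr_gt0 ?ltr0n //= ltr_pdivrMr ?ltr0n // ltr_pMr //.
    by rewrite (ltr_nat _ 1).
  rewrite map_inj_uniq ?iota_uniq // => i j /(mulfI (lt0r_neq0 e0))/invr_inj.
  by move/eqP; rewrite eqr_nat => /eqP[].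
by rewrite size_map size_iota ltnn.
Qed.

(** On the line through a point where [f] is nonzero and a point where [g] is nonzero, both become
    univariate polynomials, and [{poly R}] has no zero divisors. *)
Lemma pdeg_integral m k l (f g : 'cV[R]_m -> R) : pdeg k f -> pdeg l g ->
  (forall x, f x * g x = 0) -> (exists x, f x <> 0) -> forall x, g x = 0.
Proof.
move=> pf pg fg0 [a fa] b; apply: contrapT => gb.
have [p pE] := pdeg_line a (b - a) pf; have [q qE] := pdeg_line a (b - a) pg.
have pq0 : p * q = 0.
  by apply: (@poly_eq0_itv _ 1) => // s _; rewrite hornerM -pE -qE.
have /eqP := pq0; rewrite mulf_eq0 => /orP[]/eqP h0.
  by apply: fa; have := pE 0; rewrite scale0r addr0 h0 horner0.
by apply: gb; have := qE 1; rewrite scale1r addrC subrK h0 horner0.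
Qed.

(** The line from an interior point of the simplex to [x] stays in the simplex for small parameters,
    so [f] vanishes along the whole line. *)
Lemma pdeg_eq0_simplex m k (f : 'cV[R]_m -> R) : pdeg k f ->
  (forall y : 'cV[R]_m, (forall i, 0 <= y i ord0) -> \sum_i y i ord0 < 1 -> f y = 0) ->
  forall x, f x = 0.
Proof.
move=> pf f0 x.
(* This point leaves the same slack 1/(m+1) in each coordinate and in the bound on the sum. *)
pose c : 'cV[R]_m := const_mx (m.+1%:R^-1).
have [p pE] := pdeg_line c (x - c) pf.
suff p0 : p = 0 by have := pE 1; rewrite scale1r addrC subrK p0 horner0.
(* [M] bounds each coordinate of the direction [x - c] in absolute value, and also their sum; the
   summand 1 makes it positive. *)
pose M : R := 1 + \sum_i `|(x - c) i ord0|.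
have M0 : 0 < M by rewrite ltr_pwDl // sumr_ge0.
have m0 : 0 < m.+1%:R^-1 :> R by rewrite invr_gt0 ltr0n.
apply: (@poly_eq0_itv _ (m.+1%:R^-1 / M)); first by rewrite divr_gt0.
move=> s /andP[s0 sM]; rewrite -pE.
have sM1 : s * M < m.+1%:R^-1 by rewrite -ltr_pdivlMr.
apply: f0.
  move=> i.
  have -> : (c + s *: (x - c)) i ord0 = m.+1%:R^-1 + s * (x - c) i ord0 by rewrite !mxE.
  have h : s * `|(x - c) i ord0| <= s * M.
    rewrite ler_wpM2l ?(ltW s0) // /M (bigD1 i) //= addrCA lerDl addr_ge0 ?sumr_ge0 //.
  have h2 : s * - (x - c) i ord0 <= s * `|(x - c) i ord0|.
    by rewrite ler_wpM2l ?(ltW s0) // -normrN ler_norm.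
  by rewrite -[s * _]opprK subr_ge0 -mulrN (le_trans h2) // (le_trans h) // ltW.
have -> : \sum_i (c + s *: (x - c)) i ord0 = m%:R / m.+1%:R + s * \sum_i (x - c) i ord0.
  rewrite mulr_sumr mulr_natl -[X in _ *+ X](card_ord m) -sumr_const -big_split /=.
  by apply: eq_bigr => i _; rewrite !mxE.
have E1 : 1 = m%:R / m.+1%:R + m.+1%:R^-1 :> R.
  by rewrite -[X in _ + X]mul1r -mulrDl natr1 divff // pnatr_eq0.
rewrite [X in _ < X]E1 ltrD2l; apply: le_lt_trans sM1; rewrite ler_wpM2l ?(ltW s0) // /M.
by rewrite -[X in X <= _]add0r lerD // ler_sum // => i _; exact: ler_norm.
Qed.

(** * Restriction to the hyperplane where the first coordinate vanishes *)

Definition hyper (m : nat) (s : 'cV[R]_m) : 'cV[R]_m.+1 := col_mx (0 : 'M[R]_1) s.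
Definition tailv (m : nat) (x : 'cV[R]_m.+1) : 'cV[R]_m := @dsubmx R 1 m 1 x.

Lemma hyperE m (s : 'cV[R]_m) : hyper s = 0 + col_mx (0 : 'M[R]_(1, m)) 1%:M *m s.
Proof. by rewrite add0r mul_col_mx mul0mx mul1mx. Qed.

Lemma tailvE m (x : 'cV[R]_m.+1) : tailv x = 0 + row_mx (0 : 'M[R]_(m, 1)) 1%:M *m x.
Proof. by rewrite add0r -{2}(@vsubmxK _ 1 m 1 x) mul_row_col mul0mx mul1mx add0r. Qed.

Lemma hyperK m : cancel (@hyper m) (@tailv m).
Proof. by move=> s; rewrite /tailv /hyper col_mxKd. Qed.

Lemma hyper0 m (s : 'cV[R]_m) : hyper s ord0 ord0 = 0.
Proof.
have -> : ord0 = @lshift 1 m ord0 by apply/val_inj.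
by rewrite /hyper (@col_mxEu _ 1 m 1) mxE.
Qed.

Lemma pdeg_hyper m k (f : 'cV[R]_m.+1 -> R) : pdeg k f -> pdeg k (f \o @hyper m).
Proof.
move=> pf; have -> : f \o @hyper m = fun s => f (0 + col_mx (0 : 'M[R]_(1, m)) 1%:M *m s).
  by apply/funext => s; rewrite /= hyperE.
exact: pdeg_affine.
Qed.

Lemma pdeg_tailv m k (f : 'cV[R]_m -> R) : pdeg k f -> pdeg k (f \o @tailv m).
Proof.
move=> pf; have -> : f \o @tailv m = fun s => f (0 + row_mx (0 : 'M[R]_(m, 1)) 1%:M *m s).
  by apply/funext => s; rewrite /= tailvE.
exact: pdeg_affine.
Qed.

(** P^(k-1) with the convention that P^(-1) is zero, where the truncated [k.-1] would leave the
    constants. *)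
Definition pdeg_pred m k (g : 'cV[R]_m -> R) : Prop :=
  if k is k'.+1 then pdeg k' g else forall x, g x = 0.

(** Induction along [pdeg]: after multiplication by the first coordinate the restriction vanishes
    and the old polynomial is the quotient; any other coordinate commutes with the restriction. *)
Lemma pdeg_split m k (f : 'cV[R]_m.+1 -> R) : pdeg k f ->
  exists2 g, pdeg_pred k g & forall x, f x = f (hyper (tailv x)) + x ord0 ord0 * g x.
Proof.
elim=> [k' c|k' f1 f2 _ [g1 p1 E1] _ [g2 p2 E2]|k' i f' pf' [g pg E]].
- exists (fun=> 0); first by case: k' => //= k'; exact: pdeg_cst.
  by move=> x; rewrite mulr0 addr0.
- exists (fun x => g1 x + g2 x).
    by case: k' p1 p2 => /= [p1 p2 x|k']; [rewrite p1 p2 addr0|exact: pdegD].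
  by move=> x; rewrite {1}E1 {1}E2; ring.
- have [->|i0] := eqVneq i ord0.
    by exists f' => // x; rewrite hyper0 mul0r add0r.
  exists (fun x : 'cV[R]_m.+1 => x i ord0 * g x).
    case: k' pg {pf'} => /= [g0|k' pg]; last exact: pdegX.
    have -> : (fun x : 'cV[R]_m.+1 => x i ord0 * g x) = (fun=> 0).
      by apply/funext => x; rewrite g0 mulr0.
    exact: pdeg_cst.
  move=> x; rewrite {1}E mulrDr mulrCA; congr (_ * _ + _).
  rewrite /hyper /tailv; case: (@unliftP _ ord0 i) i0 => [j ->|->]; last by rewrite eqxx.
  have -> : lift ord0 j = rshift 1 j by apply/val_inj.
  by rewrite (@col_mxEd _ 1 m 1) mxE.
Qed.

End Polynomials.

(** * Iterated integrals of polynomials over simplices *)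

Section SimplexIntegral.
Variable R : realType.
Local Notation mu := (@lebesgue_measure R).

(** The coefficient at index 0 is a quotient by 0, hence 0, so this is the primitive that vanishes
    at 0. *)
Definition primitive (p : {poly R}) : {poly R} :=
  \poly_(i < (size p).+1) (p`_i.-1 / i%:R).

Lemma deriv_primitive (p : {poly R}) : (primitive p)^`() = p.
Proof.
apply/polyP => i; rewrite coef_deriv coef_poly ltnS; case: ltnP => [_|sp].
  by rewrite /= -[LHS]mulr_natr divfK // pnatr_eq0.
by rewrite mul0rn nth_default.
Qed.

Lemma Rintegral_poly (p : {poly R}) (a b : R) : a <= b ->
  Rintegral mu `[a, b]%classic (fun x => p.[x]) = (primitive p).[b] - (primitive p).[a].
Proof.
rewrite le_eqVlt => /predU1P[->|ab].
  by rewrite set_itv1 Rintegral_set1 subrr.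
rewrite /Rintegral (@continuous_FTC2 _ _ (horner (primitive p))) //.
- by apply: continuous_subspaceT => x; exact: continuous_horner.
- split.
  + by move=> x _; exact: derivable_horner.
  + by apply: cvg_at_right_filter; exact: continuous_horner.
  + by apply: cvg_at_left_filter; exact: continuous_horner.
- by move=> x _; rewrite -derivE deriv_primitive.
Qed.

(* Both [0, x] and [x, t] contribute nonnegatively to a zero integral, so the
   primitive vanishes on a whole interval. *)
Lemma Rintegral_poly_eq0 (p : {poly R}) (t : R) : 0 < t ->
  (forall x, 0 <= x <= t -> 0 <= p.[x]) ->
  Rintegral mu `[0, t]%classic (fun x => p.[x]) = 0 -> p = 0.
Proof.
move=> t0 p0; rewrite Rintegral_poly ?(ltW t0) // => It.
suff : primitive p - ((primitive p).[0])%:P = 0.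
  by move/(congr1 (@deriv R)); rewrite derivB derivC subr0 deriv_primitive deriv0.
apply: (@poly_eq0_itv _ _ t) => // x /andP[x0 xt].
have h1 : 0 <= Rintegral mu `[0, x]%classic (fun x => p.[x]).
  apply: Rintegral_ge0 => y /=; rewrite in_itv /= => /andP[y0 yx]; apply: p0.
  by rewrite y0 (le_trans yx (ltW xt)).
have h2 : 0 <= Rintegral mu `[x, t]%classic (fun x => p.[x]).
  apply: Rintegral_ge0 => y /=; rewrite in_itv /= => /andP[xy yt]; apply: p0.
  by rewrite yt (le_trans (ltW x0) xy).
move: h1 h2 It; rewrite !Rintegral_poly ?(ltW x0) ?(ltW xt) // !hornerE.
lra.
Qed.

(** The algebra generated by [G] and the constants. An inner integral is a function of the outer
    variables and must be known to be polynomial in them before the next integration. *)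
Inductive palg (Z : Type) (G : (Z -> R) -> Prop) : (Z -> R) -> Prop :=
| palg_gen g : G g -> palg G g
| palg_cst c : palg G (fun=> c)
| palgD f g : palg G f -> palg G g -> palg G (fun z => f z + g z)
| palgM f g : palg G f -> palg G g -> palg G (fun z => f z * g z).

Lemma palg_comp (Z Z' : Type) (G : (Z -> R) -> Prop) (G' : (Z' -> R) -> Prop)
    (h : Z' -> Z) (f : Z -> R) :
  (forall g, G g -> palg G' (g \o h)) -> palg G f -> palg G' (f \o h).
Proof.
move=> Gh; elim=> [g Gg|c|f1 f2 _ p1 _ p2|f1 f2 _ p1 _ p2].
- exact: Gh.
- exact: palg_cst.
- exact: palgD p1 p2.
- exact: palgM p1 p2.
Qed.

Lemma palg_sum (Z : Type) (G : (Z -> R) -> Prop) (n : nat) (F : 'I_n -> Z -> R) :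
  (forall i, palg G (F i)) -> palg G (fun z => \sum_(i < n) F i z).
Proof.
elim: n F => [|n IH] F pF.
  have -> : (fun z => \sum_(i < 0) F i z) = (fun=> 0).
    by apply/funext => z; rewrite big_ord0.
  exact: palg_cst.
have -> : (fun z => \sum_(i < n.+1) F i z) = (fun z => F ord0 z + \sum_(i < n) F (lift ord0 i) z).
  by apply/funext => z; rewrite big_ord_recl.
by apply: palgD => //; apply: IH => i.
Qed.

Definition gens_prod (Z Y : Type) (G : (Z -> R) -> Prop) (H : (Y -> R) -> Prop)
    (g : Z * Y -> R) : Prop :=
  (exists2 g0, G g0 & g = g0 \o fst) \/ (exists2 h0, H h0 & g = h0 \o snd).

Definition coords (m : nat) (g : 'cV[R]_m -> R) : Prop :=
  exists i, g = fun x => x i ord0.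

(** Powers of the last variable are collected. The size bound [n] is uniform in [z], so that
    integration yields a sum of fixed length with coefficients in the algebra. *)
Lemma palg_poly (Z : Type) (G : (Z -> R) -> Prop) (f : Z * R -> R) :
  palg (gens_prod G (eq id)) f ->
  exists n (P : Z -> {poly R}),
    [/\ forall z, (size (P z) <= n)%N, forall i, palg G (fun z => (P z)`_i) &
        forall z x, f (z, x) = (P z).[x]].
Proof.
elim=> [g [[g0 Gg ->]|[h0 <- ->]]|c|f1 f2 _ [n1 [P1 [s1 c1 e1]]] _ [n2 [P2 [s2 c2 e2]]]
  |f1 f2 _ [n1 [P1 [s1 c1 e1]]] _ [n2 [P2 [s2 c2 e2]]]].
- exists 1%N, (fun z => (g0 z)%:P); split=> [z|[|i]|z x].
  + by rewrite size_polyC leq_b1.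
  + have -> : (fun z => (g0 z)%:P`_0) = g0 by apply/funext => z; rewrite coefC.
    exact: palg_gen.
  + have -> : (fun z => (g0 z)%:P`_i.+1) = (fun=> 0) by apply/funext => z; rewrite coefC.
    exact: palg_cst.
  + by rewrite hornerC.
- exists 2%N, (fun=> 'X); split=> [z|i|z x]; rewrite ?size_polyX ?hornerX //.
  exact: palg_cst.
- exists 1%N, (fun=> c%:P); split=> [z|i|z x]; rewrite ?size_polyC ?leq_b1 ?hornerC //.
  exact: palg_cst.
- exists (maxn n1 n2), (fun z => P1 z + P2 z); split=> [z|i|z x].
  + by rewrite (leq_trans (size_polyD _ _)) // geq_max !leq_max s1 s2 orbT.
  + have -> : (fun z => (P1 z + P2 z)`_i) = (fun z => (P1 z)`_i + (P2 z)`_i).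
      by apply/funext => z; rewrite coefD.
    exact: palgD.
  + by rewrite hornerD e1 e2.
- exists (n1 + n2)%N, (fun z => P1 z * P2 z); split=> [z|i|z x].
  + by rewrite (leq_trans (size_polyMleq _ _)) // (leq_trans (leq_pred _)) // leq_add.
  + have -> : (fun z => (P1 z * P2 z)`_i) = (fun z => \sum_(j < i.+1) (P1 z)`_j * (P2 z)`_(i - j)).
      by apply/funext => z; rewrite coefM.
    by apply: palg_sum => j; exact: palgM.
  + by rewrite hornerM e1 e2.
Qed.

Lemma primitive_horner (p : {poly R}) n (t : R) : (size p <= n)%N ->
  (primitive p).[t] = \sum_(i < n) p`_i / i.+1%:R * t ^+ i.+1.
Proof.
move=> sp; have sq : (size (primitive p) <= n.+1)%N.
  by rewrite (leq_trans (size_poly _ _)).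
rewrite (horner_coef_wide _ sq) big_ord_recl coef_poly /= invr0 mulr0 mul0r add0r.
apply: eq_bigr => i _; rewrite coef_poly /bump /= add1n ltnS.
by case: ltnP => // h; rewrite [p`_i]nth_default ?mul0r.
Qed.

Lemma palgX (Z : Type) (G : (Z -> R) -> Prop) (f : Z -> R) n :
  palg G f -> palg G (fun z => f z ^+ n).
Proof.
move=> pf; elim: n => [|n IH]; first exact: palg_cst.
have -> : (fun z => f z ^+ n.+1) = (fun z => f z * f z ^+ n).
  by apply/funext => z; rewrite exprS.
exact: palgM.
Qed.

(* The parameter space Z is arbitrary so that the variable of each outer
   integral can be absorbed into it. *)
Lemma simplex_int_palg (m : nat) (Z : Type) (G : (Z -> R) -> Prop) (t : Z -> R)
    (f : Z * 'cV[R]_m -> R) :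
  palg G t -> palg (gens_prod G (@coords m)) f ->
  exists2 h, palg G h & forall z, 0 <= t z -> simplex_int (t z) (fun y => f (z, y)) = h z.
Proof.
elim: m Z G t f => [|m IH] Z G t f pt pf.
  exists (f \o (fun z => (z, 0))) => //.
  apply: palg_comp pf => g [[g0 Gg ->]|[h0 [[]]//]].
  exact: palg_gen.
(* The outer integration variable joins the parameters, and the remaining simplex has size
   [t z - x], which lies in the enlarged algebra. *)
pose G' := gens_prod G (eq (@id R)).
pose t' (zx : Z * R) := t zx.1 - zx.2.
pose f' (w : (Z * R) * 'cV[R]_m) := f (w.1.1, col_mx (w.1.2%:M : 'M[R]_1) w.2).
have pt' : palg G' t'.
  have -> : t' = (fun zx => (t \o fst) zx + (fun=> -1) zx * snd zx).
    by apply/funext => zx; rewrite mulN1r.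
  apply: palgD.
    by apply: palg_comp pt => g Gg; apply: palg_gen; left; exists g.
  by apply: palgM; [exact: palg_cst|apply: palg_gen; right; exists id].
have pf' : palg (gens_prod G' (@coords m)) f'.
  apply: (@palg_comp _ _ _ _
    (fun w : (Z * R) * 'cV[R]_m => (w.1.1, col_mx (w.1.2%:M : 'M[R]_1) w.2)) _ _ pf).
  move=> g [[g0 Gg ->]|[h0 [i ->] ->]].
    by apply: palg_gen; left; exists (g0 \o fst) => //; left; exists g0.
  case: (@splitP 1 m i) => j ij.
    have -> : i = @lshift 1 m ord0 by apply/val_inj; rewrite /= ij ord1.
    apply: palg_gen; left; exists snd; first by right; exists id.
    by apply/funext => w /=; rewrite (@col_mxEu _ 1 m 1) mxE eqxx mulr1n.
  have -> : i = @rshift 1 m j by apply/val_inj; rewrite /= ij.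
  apply: palg_gen; right; exists (fun x => x j ord0); first by exists j.
  by apply/funext => w /=; rewrite (@col_mxEd _ 1 m 1).
have [h ph hE] := IH _ _ _ _ pt' pf'.
have [n [P [sP cP eP]]] := palg_poly ph.
exists (fun z => \sum_(i < n) (P z)`_i / i.+1%:R * t z ^+ i.+1).
  apply: palg_sum => i; apply: palgM; last exact: palgX.
  by apply: palgM => //; exact: palg_cst.
move=> z tz; rewrite -primitive_horner //=.
have -> : (primitive (P z)).[t z] = (primitive (P z)).[t z] - (primitive (P z)).[0].
  by rewrite horner_coef0 coef_poly /= invr0 mulr0 subr0.
rewrite -Rintegral_poly //; apply: eq_Rintegral => x.
rewrite inE /= in_itv /= => /andP[x0 xt].
by rewrite -eP -hE /t' /f' /= ?subr_ge0.
Qed.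

Lemma simplex_int_ge0 (m : nat) (t : R) (f : 'cV[R]_m -> R) :
  (forall y, 0 <= f y) -> 0 <= simplex_int t f.
Proof.
elim: m t f => [|m IH] t f f0 //=.
by apply: Rintegral_ge0 => x _; exact: IH.
Qed.

Lemma pdeg_palg (m k : nat) (f : 'cV[R]_m -> R) : pdeg k f -> palg (@coords m) f.
Proof.
elim=> [k' c|k' f1 f2 _ p1 _ p2|k' i f' _ pf].
- exact: palg_cst.
- exact: palgD.
- by apply: palgM => //; apply: palg_gen; exists i.
Qed.

(** Induction on the dimension. The integral over a slice is a polynomial in the first coordinate,
    nonnegative on [0, t] and with zero integral, hence zero; every slice below [t] then falls under
    the induction hypothesis with the remaining size. *)
Lemma simplex_int_eq0 (m k : nat) (t : R) (f : 'cV[R]_m -> R) :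
  pdeg k f -> 0 < t -> (forall y, 0 <= f y) -> simplex_int t f = 0 ->
  forall y : 'cV[R]_m, (forall i, 0 <= y i ord0) -> \sum_i y i ord0 < t -> f y = 0.
Proof.
elim: m t f => [|m IH] t f pf t0 f0 /= If y y0 yt.
  by rewrite -If; congr f; apply/matrixP => -[].
have pt : palg (eq (@id R)) (fun x => t - x).
  have -> : (fun x => t - x) = (fun x => t + (fun=> -1) x * x).
    by apply/funext => x; rewrite mulN1r.
  by apply: palgD; [exact: palg_cst|apply: palgM; [exact: palg_cst|exact: palg_gen]].
pose F (w : R * 'cV[R]_m) := f (col_mx (w.1%:M : 'M[R]_1) w.2).
have pF : palg (gens_prod (eq (@id R)) (@coords m)) F.
  apply: (@palg_comp _ _ _ _
    (fun w : R * 'cV[R]_m => col_mx (w.1%:M : 'M[R]_1) w.2) _ _ (pdeg_palg pf)).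
  move=> g [i ->]; case: (@splitP 1 m i) => j ij.
    have -> : i = @lshift 1 m ord0 by apply/val_inj; rewrite /= ij ord1.
    apply: palg_gen; left; exists id => //.
    by apply/funext => w /=; rewrite (@col_mxEu _ 1 m 1) mxE eqxx mulr1n.
  have -> : i = @rshift 1 m j by apply/val_inj; rewrite /= ij.
  apply: palg_gen; right; exists (fun x => x j ord0); first by exists j.
  by apply/funext => w /=; rewrite (@col_mxEd _ 1 m 1).
have [h ph hE] := simplex_int_palg pt pF.
(* Over a one-point parameter space the collected form is a single polynomial in the slice
   variable. *)
have [p pE] : exists p : {poly R}, forall x, h x = p.[x].
  have : palg (gens_prod (fun _ : unit -> R => False) (eq id)) (h \o snd).
    by apply: palg_comp ph => g <-; apply: palg_gen; right; exists id.
  by case/palg_poly => n [P [_ _ eP]]; exists (P tt) => x; rewrite -eP.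
have pge0 x : 0 <= x <= t -> 0 <= p.[x].
  by move=> /andP[_ xt]; rewrite -pE -hE ?subr_ge0 //; apply: simplex_int_ge0 => z; exact: f0.
have p0 : p = 0.
  apply: (@Rintegral_poly_eq0 _ t) => //; rewrite -[RHS]If; apply: eq_Rintegral => x.
  by rewrite inE /= in_itv /= => /andP[x0 xt]; rewrite -pE; rewrite -hE ?subr_ge0.
have yE : y = col_mx ((y ord0 ord0)%:M : 'M[R]_1) (tailv y).
  rewrite -[LHS](@vsubmxK _ 1 m 1); congr (@col_mx _ 1 m 1 _ _).
  by apply/matrixP => i j; rewrite !mxE !ord1 eqxx mulr1n; congr (y _ _); apply/val_inj.
have tailE i : tailv y i ord0 = y (lift ord0 i) ord0.
  by rewrite /tailv mxE; congr (y _ _); apply/val_inj.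
move: yt; rewrite big_ord_recl => yt.
rewrite yE; apply: (IH (t - y ord0 ord0) (fun y' => f (col_mx ((y ord0 ord0)%:M : 'M[R]_1) y'))).
- have -> : (fun y' => f (col_mx ((y ord0 ord0)%:M : 'M[R]_1) y')) =
     (fun y' => f (col_mx ((y ord0 ord0)%:M : 'M[R]_1) 0 + col_mx 0 1%:M *m y')).
    apply/funext => y'; congr f.
    by rewrite mul_col_mx mul0mx mul1mx add_col_mx addr0 add0r.
  exact: pdeg_affine.
- rewrite subr_gt0; apply: le_lt_trans yt; rewrite lerDl sumr_ge0 // => i _; exact: y0.
- by move=> y'; exact: f0.
- have := hE (y ord0 ord0); rewrite pE p0 horner0; apply.
  rewrite subr_ge0 ltW //; apply: le_lt_trans yt; rewrite lerDl sumr_ge0 // => i _; exact: y0.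
- by move=> i; rewrite tailE.
- by rewrite (eq_bigr _ (fun i _ => tailE i)) ltrBrDl.
Qed.

Lemma simplex_int_pdeg_eq0 (m k : nat) (f : 'cV[R]_m -> R) :
  pdeg k f -> (forall y, 0 <= f y) -> simplex_int 1 f = 0 -> forall x, f x = 0.
Proof.
move=> pf f0 If; apply: (pdeg_eq0_simplex pf) => y.
exact: (simplex_int_eq0 pf ltr01 f0 If).
Qed.

End SimplexIntegral.

(** * Euclidean inner product and tangential projection *)

Section DotProduct.
Variables (R : realType) (m : nat).
Implicit Types a b c : 'cV[R]_m.

Lemma dotvE a b : dotv a b = (a^T *m b) ord0 ord0.
Proof. by rewrite mxE; apply: eq_bigr => i _; rewrite mxE. Qed.

Lemma dotvC a b : dotv a b = dotv b a.
Proof. by apply: eq_bigr => i _; rewrite mulrC. Qed.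

Lemma dotvDl a b c : dotv (a + b) c = dotv a c + dotv b c.
Proof. by rewrite !dotvE linearD mulmxDl mxE. Qed.

Lemma dotvZl x a b : dotv (x *: a) b = x * dotv a b.
Proof. by rewrite !dotvE linearZ -scalemxAl mxE. Qed.

Lemma dotvBl a b c : dotv (a - b) c = dotv a c - dotv b c.
Proof. by rewrite dotvDl -scaleN1r dotvZl mulN1r. Qed.

Lemma dotvBr a b c : dotv a (b - c) = dotv a b - dotv a c.
Proof. by rewrite dotvC dotvBl !(dotvC a). Qed.

Lemma dotv_suml (I : finType) (F : I -> 'cV[R]_m) b :
  dotv (\sum_i F i) b = \sum_i dotv (F i) b.
Proof.
apply: (big_morph (fun x => dotv x b) (fun x y => dotvDl x y b)).
by apply: big1 => i _; rewrite mxE mul0r.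
Qed.

Lemma dotv_ge0 a : 0 <= dotv a a.
Proof. by apply: sumr_ge0 => i _; rewrite -expr2 sqr_ge0. Qed.

Lemma dotv_eq0 a : dotv a a = 0 -> a = 0.
Proof.
move=> /eqP; rewrite psumr_eq0 => [|i _]; last by rewrite -expr2 sqr_ge0.
move=> /allP a0; apply/colP => i; rewrite mxE; apply/eqP.
by have := a0 i (mem_index_enum i); rewrite /= mulf_eq0 orbb.
Qed.

Lemma tntE (n : 'cV[R]_m) (A : 'M[R]_m) : tnt n A = (1%:M - n *m n^T) *m (A *m n).
Proof.
rewrite mulmxBl mul1mx -mulmxA /tnt dotvE; congr (_ - _).
by rewrite (mx11_scalar (n^T *m _)) mul_mx_scalar mxE eqxx mulr1n.
Qed.

End DotProduct.

(** * Facets, barycentric gradients and tangential-normal components *)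

Section Geometry.
Variables (R : realType) (m : nat) (v : 'I_m.+2 -> 'cV[R]_m.+1).

Lemma fvertE j (i : nat) (o : 'I_m.+1) : i = o -> fvert v j i = v (lift j o).
Proof. by move=> ->; rewrite /fvert valK. Qed.

Lemma phiF_lift j s : phiF v j s = v (lift j ord0) + jacF v j *m s.
Proof. by rewrite /phiF (@fvertE _ _ ord0). Qed.

(** The first column leads from the facet to the opposite vertex, the others run along the facet.
    The first coordinate in [facet_chart] is thus the barycentric coordinate of vertex [j]. *)
Definition facet_frame (j : 'I_m.+2) : 'M[R]_m.+1 :=
  row_mx (v j - v (lift j ord0)) (jacF v j).

Definition facet_chart (j : 'I_m.+2) (x : 'cV[R]_m.+1) : 'cV[R]_m.+1 :=
  v (lift j ord0) + facet_frame j *m x.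

(** The first row of the inverse frame is the derivative of the first chart coordinate. *)
Definition bary_grad (j : 'I_m.+2) : 'cV[R]_m.+1 :=
  (row ord0 (invmx (facet_frame j)))^T.

(** The numbers t^T A n for the facet edges t, with the gradient in place of a unit normal n, which
    avoids a sign choice and a square root. *)
Definition shear (j : 'I_m.+2) (A : 'M[R]_m.+1) : 'cV[R]_m :=
  (jacF v j)^T *m A *m bary_grad j.

Lemma facet_chart_hyper j s : facet_chart j (hyper s) = phiF v j s.
Proof.
rewrite phiF_lift /facet_chart /facet_frame /hyper.
by rewrite (@mul_row_col _ _ 1 m 1) mulmx0 add0r.
Qed.

Lemma jacF_dotv j (u : 'cV[R]_m.+1) (i : 'I_m) :
  ((jacF v j)^T *m u) i ord0 = dotv u (v (lift j (lift ord0 i)) - v (lift j ord0)).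
Proof.
rewrite mxE dotvC; apply: eq_bigr => a _; rewrite !mxE.
by rewrite (@fvertE _ _ (lift ord0 i)) // (@fvertE _ _ ord0).
Qed.

Lemma jacF_perp j (u : 'cV[R]_m.+1) :
  (jacF v j)^T *m u = 0 <->
  forall i i' : 'I_m.+1, dotv u (v (lift j i) - v (lift j i')) = 0.
Proof.
split=> [u0|u0]; last by apply/colP => i; rewrite jacF_dotv u0 mxE.
have base i : dotv u (v (lift j i) - v (lift j ord0)) = 0.
  case: (unliftP ord0 i) => [i' ->|->]; last by rewrite subrr dotvE mulmx0 mxE.
  by rewrite -jacF_dotv u0 mxE.
by move=> i i'; have := base i; have := base i'; rewrite !dotvBr => ? ?; lra.
Qed.

Hypothesis nd : nondegen_simplex v.

Lemma perp_edges_eq0 (u : 'cV[R]_m.+1) b : (forall a, dotv u (v a - v b) = 0) -> u = 0.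
Proof.
move=> u0; have : u^T *m jacT v = 0.
  apply/rowP => i; rewrite [RHS]mxE.
  have -> : (u^T *m jacT v) ord0 i = dotv u (v (lift ord0 i) - v ord0).
    by rewrite mxE; apply: eq_bigr => a _; rewrite !mxE.
  have := u0 (lift ord0 i); have := u0 ord0; rewrite !dotvBr => ? ?; lra.
move=> /(congr1 (mulmx^~ (invmx (jacT v)))); rewrite mulmxK // mul0mx => u1.
by rewrite -[u]trmxK u1 trmx0.
Qed.

Lemma perp_frame_eq0 j (u : 'cV[R]_m.+1) :
  dotv u (v j - v (lift j ord0)) = 0 -> (jacF v j)^T *m u = 0 -> u = 0.
Proof.
move=> uj /jacF_perp u0; apply: (@perp_edges_eq0 _ (lift j ord0)) => a.
by case: (unliftP j a) => [i ->|->].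
Qed.

Lemma facet_frame_unit j : facet_frame j \in unitmx.
Proof.
rewrite -row_free_unit; apply: inj_row_free => u.
rewrite /facet_frame (@mul_mx_row _ _ _ 1 m) => uK.
have [u1 u2] := @eq_row_mx _ 1 1 m _ _ _ _ (etrans uK (esym (@row_mx0 _ 1 1 m))).
rewrite -[u]trmxK; apply/eqP; rewrite trmx_eq0; apply/eqP.
apply: (@perp_frame_eq0 j); first by rewrite dotvE trmxK u1 mxE.
by rewrite -trmx_mul u2 trmx0.
Qed.

Lemma bary_grad_frame j : (bary_grad j)^T *m facet_frame j = row ord0 1%:M.
Proof. by rewrite /bary_grad trmxK -row_mul mulVmx // facet_frame_unit. Qed.

Lemma bary_grad_opp j : dotv (bary_grad j) (v j - v (lift j ord0)) = 1.
Proof.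
have /(congr1 (@lsubmx R 1 1 m)) := bary_grad_frame j.
rewrite /facet_frame (@mul_mx_row _ _ _ 1 m) row_mxKl dotvE => ->.
by rewrite !mxE; case: eqP => // h; case: h; apply/val_inj.
Qed.

Lemma jacF_bary_grad j : (jacF v j)^T *m bary_grad j = 0.
Proof.
have /(congr1 (@rsubmx R 1 1 m)) := bary_grad_frame j.
rewrite /facet_frame (@mul_mx_row _ _ _ 1 m) row_mxKr => h.
apply: trmx_inj; rewrite trmx_mul (trmxK (jacF v j)) h.
by apply/rowP => i; rewrite !mxE; case: eqP => // /(congr1 val).
Qed.

(** The barycentric coordinate is affine, 1 at its own vertex and 0 at all others. *)
Lemma bary_gradP j a b :
  dotv (bary_grad j) (v a - v b) = (a == j)%:R - (b == j)%:R.
Proof.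
have base c : dotv (bary_grad j) (v c - v (lift j ord0)) = (c == j)%:R.
  case: (unliftP j c) => [i ->|->]; last by rewrite eqxx bary_grad_opp.
  by rewrite eq_sym (negPf (neq_lift _ _)); exact/(jacF_perp j _).1/jacF_bary_grad.
by have := base a; have := base b; rewrite !dotvBr => <- <-; ring.
Qed.

(** Once the multiple determined by the transversal edge is subtracted, the vector is orthogonal to
    the whole frame. *)
Lemma perp_bary_grad j (u : 'cV[R]_m.+1) : (jacF v j)^T *m u = 0 ->
  exists c, u = c *: bary_grad j.
Proof.
move=> u0; exists (dotv u (v j - v (lift j ord0))); apply/subr0_eq.
apply: (@perp_frame_eq0 j); first by rewrite dotvBl dotvZl bary_grad_opp mulr1 subrr.
by rewrite mulmxBr u0 -scalemxAr jacF_bary_grad scaler0 subr0.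
Qed.

Lemma bary_grad_neq0 j : bary_grad j <> 0.
Proof.
move=> h; have := bary_grad_opp j; rewrite h dotvE trmx0 mul0mx mxE => /eqP.
by rewrite eq_sym oner_eq0.
Qed.

Lemma unit_normal_exists j : exists n, unit_normal v j n.
Proof.
pose N := bary_grad j; have N0 : 0 < dotv N N.
  rewrite lt_neqAle dotv_ge0 andbT eq_sym; apply/eqP => /dotv_eq0.
  exact: bary_grad_neq0.
exists ((Num.sqrt (dotv N N))^-1 *: N); split.
  rewrite dotvZl dotvC dotvZl mulrA -invfM -expr2 sqr_sqrtr ?ltW //.
  by rewrite mulVf // lt0r_neq0.
move=> i i'; rewrite dotvZl.
by have /jacF_perp -> := jacF_bary_grad j; rewrite mulr0.
Qed.

Lemma unit_normalP j n : unit_normal v j n ->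
  exists2 c, c != 0 & n = c *: bary_grad j.
Proof.
move=> [n1 /jacF_perp/perp_bary_grad[c nE]]; exists c => //; apply/eqP => c0.
by move: n1; rewrite nE c0 scale0r dotvE mulmx0 mxE => /eqP; rewrite eq_sym oner_eq0.
Qed.

(** The transposed facet Jacobian annihilates the normal, so the normal part subtracted in [tnt]
    disappears. *)
Lemma jacF_tnt j n : unit_normal v j n ->
  exists2 c, c != 0 & forall A, (jacF v j)^T *m tnt n A = c *: shear j A.
Proof.
move=> un; have [c c0 nE] := unit_normalP un; exists c => // A.
have [_ /jacF_perp n0] := un.
rewrite /tnt mulmxBr -scalemxAr n0 scaler0 subr0 nE -scalemxAr /shear.
by rewrite -scalemxAr mulmxA.
Qed.

(** The projection along the normal forgets exactly what [shear] does not see, so [tnt] depends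
    linearly on [shear]. *)
Lemma tnt_shear j n : unit_normal v j n ->
  exists Q : 'M[R]_(m.+1, m), forall A, tnt n A = Q *m shear j A.
Proof.
move=> un; have [c c0 nE] := unit_normalP un; have [n1 _] := un.
pose P := 1%:M - n *m n^T.
pose E : 'M[R]_(m.+1, m) := col_mx (0 : 'M[R]_(1, m)) 1%:M.
pose K := facet_frame j; have Ku : K^T \in unitmx by rewrite unitmx_tr facet_frame_unit.
(* [invmx K^T *m E] is a right inverse of [(jacF v j)^T]; the vector rebuilt from [shear] therefore
   differs from [A *m n] by a multiple of the normal, which [P] kills. *)
exists (c *: (P *m invmx K^T *m E)) => A.
have Pn : P *m n = 0.
  rewrite mulmxBl mul1mx -mulmxA (mx11_scalar (n^T *m n)) -dotvE n1.
  by rewrite mulmx1 subrr.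
have JE : (jacF v j)^T *m (invmx K^T *m E) = 1%:M.
  have /(congr1 (@dsubmx R 1 m m)) : K^T *m (invmx K^T *m E) = E by rewrite mulKVmx.
  by rewrite {1}/K /facet_frame (@tr_row_mx _ _ 1 m) (@mul_col_mx _ 1 m) !(@col_mxKd _ 1 m).
pose w := A *m n - c *: (invmx K^T *m E *m shear j A).
have [c' wE] : exists c', w = c' *: bary_grad j.
  apply: perp_bary_grad; rewrite mulmxBr -scalemxAr (mulmxA (jacF v j)^T _ (shear j A)) JE mul1mx.
  by rewrite nE -!scalemxAr mulmxA subrr.
have Pw : P *m w = 0.
  have -> : w = (c' / c) *: n by rewrite wE nE scalerA divfK.
  by rewrite -scalemxAr Pn scaler0.
rewrite tntE -/P -[A *m n](subrK (c *: (invmx K^T *m E *m shear j A))) -/w.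
by rewrite mulmxDr Pw add0r -scalemxAr -scalemxAl !mulmxA.
Qed.

Lemma sum_bary_grad : \sum_j bary_grad j = 0.
Proof.
apply: (@perp_edges_eq0 _ ord0) => a; rewrite dotv_suml.
rewrite (eq_bigr _ (fun j _ => bary_gradP j a ord0)) sumrB.
have one b : \sum_(j < m.+2) (b == j)%:R = 1 :> R.
  by rewrite (bigD1 b) //= eqxx big1 ?addr0 // => j /negPf; rewrite eq_sym => ->.
by rewrite !one subrr.
Qed.

(* All barycentric gradients are eigenvectors; their only linear relation
   has equal coefficients, so the eigenvalues coincide. *)
Lemma shear_inj (A : 'M[R]_m.+1) : \tr A = 0 -> (forall j, shear j A = 0) -> A = 0.
Proof.
move=> trA sA.
have /(_ _)/cid eig j : exists c, A *m bary_grad j = c *: bary_grad j.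
  by apply: perp_bary_grad; rewrite mulmxA; exact: sA.
pose c j := sval (eig j); have cE j : A *m bary_grad j = c j *: bary_grad j.
  by rewrite /c; case: (eig j).
have sum0 : \sum_j c j *: bary_grad j = 0.
  by rewrite -(eq_bigr _ (fun j _ => cE j)) -mulmx_sumr sum_bary_grad mulmx0.
have ceq a : c a = c ord0.
  apply/eqP; rewrite -subr_eq0; apply/eqP.
  (* Testing the relation against an edge isolates the difference of two eigenvalues. *)
  have : dotv (\sum_j c j *: bary_grad j) (v a - v ord0) = 0.
    by rewrite sum0 dotvE trmx0 mul0mx mxE.
  rewrite dotv_suml => <-.
  rewrite (eq_bigr (fun j => c j * (a == j)%:R - c j * (ord0 == j)%:R)); last first.
    by move=> j _; rewrite dotvZl bary_gradP mulrBr.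
  have pick b : \sum_(j < m.+2) c j * (b == j)%:R = c b.
    rewrite (bigD1 b) //= eqxx mulr1 big1 ?addr0 // => j /negPf.
    by rewrite eq_sym => ->; rewrite mulr0.
  by rewrite sumrB !pick.
(* The gradients of all vertices but the first form the inverse transpose of [jacT v], hence a basis
   of eigenvectors. *)
pose N : 'M[R]_m.+1 := \matrix_(a, i) bary_grad (lift ord0 i) a ord0.
have NJ : N *m (jacT v)^T = 1%:M.
  apply: mulmx1C; rewrite -[LHS]trmxK trmx_mul trmxK.
  suff -> : N^T *m jacT v = 1%:M by rewrite trmx1.
  apply/matrixP => i i'; rewrite mxE.
  transitivity (dotv (bary_grad (lift ord0 i)) (v (lift ord0 i') - v ord0)).
    by apply: eq_bigr => a _; rewrite !mxE.
  by rewrite bary_gradP (negPf (neq_lift _ _)) subr0 (inj_eq lift_inj) eq_sym mxE.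
have AE : A = (c ord0)%:M.
  apply/subr0_eq; rewrite -[LHS]mulmx1 -NJ mulmxA.
  suff -> : (A - (c ord0)%:M) *m N = 0 by rewrite mul0mx.
  apply/matrixP => a i.
  transitivity (((A - (c ord0)%:M) *m bary_grad (lift ord0 i)) a ord0).
    by rewrite !mxE; apply: eq_bigr => b _; rewrite !mxE.
  by rewrite mulmxBl cE mul_scalar_mx ceq subrr !mxE.
move: trA; rewrite AE mxtrace_scalar => /eqP; rewrite mulrn_eq0 /= => /eqP ->.
exact: raddf0.
Qed.

Lemma shear_linear j a A B : shear j (a *: A + B) = a *: shear j A + shear j B.
Proof. by rewrite /shear mulmxDr mulmxDl -scalemxAr -scalemxAl. Qed.

Lemma shearB j A B : shear j (A - B) = shear j A - shear j B.
Proof. by rewrite /shear mulmxBr mulmxBl. Qed.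

(* Injectivity suffices: (m+2) m + 1 = (m+1)^2. *)
Lemma shear_surj : exists S : 'M[R]_(m.+2, m) -> 'M[R]_m.+1,
  [/\ linear S, forall W, \tr (S W) = 0 & forall W j i, shear j (S W) i ord0 = W j i].
Proof.
(* With the trace adjoined, the map on all matrices is injective between spaces of equal dimension;
   trace-free preimages are those of pairs [(W, 0)]. *)
pose f (A : 'M[R]_m.+1) : 'M[R]_(m.+2, m) * R^o :=
  (\matrix_(j, i) shear j A i ord0, \tr A).
have flin : linear f.
  move=> a A B; congr (_, _); last by rewrite /= linearP.
  by apply/matrixP => j i; rewrite mxE shear_linear !mxE.
pose fl : {linear _ -> _} := HB.pack f (GRing.isLinear.Build _ _ _ _ f flin).
pose F := linfun fl.
have FE A : F A = f A by rewrite lfunE.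
have kF : lker F == 0%VS.
  apply/lker0P => A B; rewrite !FE => -[] /matrixP sAB trAB.
  apply/subr0_eq/shear_inj.
    by rewrite linearB /= trAB subrr.
  move=> j; rewrite shearB; apply/eqP; rewrite subr_eq0; apply/eqP/colP => i.
  by have := sAB j i; rewrite mxE => ->; rewrite mxE.
have imF : limg F = fullv.
  apply/eqP; rewrite -dimv_leqif_eq ?subvf // limg_dim_eq ?dimvf.
    apply/eqP; transitivity (m.+2 * m + 1)%N => //; rewrite /dim /=; lia.
  by rewrite (eqP kF) capv0.
have FK W : F (F^-1%VF W) = W by rewrite limg_lfunVK // imF memvf.
exists (fun W => F^-1%VF (W, 0)); split.
- move=> a W W'; rewrite -linearP; congr (F^-1%VF _); congr (_, _).
  by rewrite /= scaler0 addr0.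
- by move=> W; have := FK (W, 0); rewrite FE => -[].
- by move=> W j i; have := FK (W, 0); rewrite FE => -[] /matrixP/(_ j i); rewrite mxE.
Qed.

(* With the unit normal added as a column, the Gram matrix becomes a square. *)
Lemma gram_gt0 j : 0 < \det ((jacF v j)^T *m jacF v j).
Proof.
have [n un] := unit_normal_exists j.
have [c c0 nE] := unit_normalP un; have [n1 /jacF_perp n0] := un.
pose K : 'M[R]_m.+1 := row_mx n (jacF v j).
have KK : K^T *m K = block_mx (1%:M : 'M[R]_1) 0 0 ((jacF v j)^T *m jacF v j).
  rewrite /K (@tr_row_mx _ _ 1 m) (@mul_col_row _ 1 m _ 1 m).
  congr (@block_mx _ 1 m 1 m _ _ _ _) => //.
    by rewrite (mx11_scalar (n^T *m n)) -dotvE n1.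
  by apply: trmx_inj; rewrite trmx_mul trmxK n0 trmx0.
have /(congr1 determinant) := KK.
rewrite det_mulmx det_tr (@det_ublock _ 1 m) det1 mul1r => <-.
rewrite -expr2 lt_neqAle sqr_ge0 andbT eq_sym sqrf_eq0 -unitfE -unitmxE.
rewrite -row_free_unit; apply: inj_row_free => u.
rewrite /K (@mul_mx_row _ _ _ 1 m) => uK.
have [u1 u2] := @eq_row_mx _ 1 1 m _ _ _ _ (etrans uK (esym (@row_mx0 _ 1 1 m))).
have /perp_bary_grad[e uE] : (jacF v j)^T *m u^T = 0 by rewrite -trmx_mul u2 trmx0.
have ue : u^T = (e / c) *: n by rewrite uE nE scalerA divfK.
have : dotv u^T n = 0 by rewrite dotvE trmxK u1 mxE.
rewrite ue dotvZl n1 mulr1 => ec0.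
by rewrite -[u]trmxK ue ec0 scale0r trmx0.
Qed.

End Geometry.

(** * Dimensions of polynomial spaces with a prescribed trace space *)

Section PolynomialSpaces.
Variable R : realType.

Lemma lin_subspace_pdeg m k : lin_subspace (fun f : 'cV[R]_m -> R^o => pdeg k f).
Proof. by split=> [|a f g pf pg]; [exact: pdeg_cst|exact: pdeg_linear]. Qed.

Lemma dimis_cst m (S : ('cV[R]_m -> R^o) -> Prop) :
  (forall c, S (fun=> c)) -> (forall f, S f -> forall x, f x = f 0) -> dimis S 1.
Proof.
move=> Sc cS; exists unit, (fun=> fun=> 1); split=> //.
- by rewrite card_unit.
- move=> c /(congr1 (fun f => f 0)); rewrite fct_sumE (bigD1 tt) //= big1; last by case.
  by rewrite addr0 scalrfctE => /eqP; rewrite /GRing.scale /= mulr1 => /eqP c0 [].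
- move=> f Sf; exists (fun=> f 0); apply/funext => x.
  rewrite fct_sumE (bigD1 tt) //= big1; last by case.
  by rewrite addr0 scalrfctE (cS f Sf) /GRing.scale /= mulr1.
Qed.

(** Such a function is uniquely x_0 g plus its trace extended constantly in x_0, with g of degree at
    most k and the trace in [S]. *)
Lemma dimis_trace m k (S : ('cV[R]_m -> R^o) -> Prop) N1 N2 :
  lin_subspace S -> (forall f, S f -> pdeg k.+1 f) ->
  dimis (fun f : 'cV[R]_m.+1 -> R^o => pdeg k f) N1 -> dimis S N2 ->
  dimis (fun f : 'cV[R]_m.+1 -> R^o => pdeg k.+1 f /\ S (f \o @hyper R m)) (N1 + N2).
Proof.
move=> sS Sp; pose phi1 (g : 'cV[R]_m.+1 -> R^o) : 'cV[R]_m.+1 -> R^o :=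
  fun x => x ord0 ord0 * g x.
pose phi2 (f : 'cV[R]_m -> R^o) : 'cV[R]_m.+1 -> R^o := f \o @tailv R m.
have hyper1 g : phi1 g \o @hyper R m = 0.
  by apply/funext => s; rewrite /phi1 /= hyper0 mul0r.
have hyper2 f : phi2 f \o @hyper R m = f.
  by apply/funext => s; rewrite /phi2 /= hyperK.
apply: (@dimis_direct_sum _ _ _ _ _ _ _ phi1 phi2) => //.
- move=> a f g; apply/funext => x; rewrite /phi1 !fctE /GRing.scale /=; ring.
- exact: lin_subspace_pdeg.
- by move=> f pf; rewrite hyper1; split; [exact: pdegX|case: sS].
- by move=> f Sf; rewrite hyper2; split=> //; exact/pdeg_tailv/Sp.
- move=> f g pf Sg fg0.
  have g0 : g = 0.
    rewrite -(hyper2 g) -[phi2 g]add0r; apply/funext => s.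
    have := congr1 (fun h => h (hyper s)) fg0; rewrite !fctE.
    by have := congr1 (fun h => h s) (hyper1 f); rewrite /= => -> ; rewrite add0r.
  split=> //; move: fg0; rewrite g0 => fg0; apply/funext => x.
  apply: (pdeg_integral (pdegX ord0 (@pdeg_cst R m.+1 0 1)) pf).
    move=> y; have := congr1 (fun h => h y) fg0.
    by rewrite /phi1 /phi2 !fctE /= addr0 mulr1.
  by exists (const_mx 1); rewrite mxE mulr1; apply/eqP; rewrite oner_eq0.
- move=> h [ph Sh]; have [g pg hE] := pdeg_split ph.
  exists g, (h \o @hyper R m); split=> //; apply/funext => x.
  by rewrite fctE {1}hE /phi1 /phi2 /= addrC.
Qed.

(** When every polynomial is an admissible trace, [dimis_trace] becomes Pascal's rule. *)
Lemma dimis_pdeg m k : dimis (fun f : 'cV[R]_m -> R^o => pdeg k f) 'C(m + k, m).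
Proof.
elim: m k => [|m IHm] k.
  rewrite bin0; apply: dimis_cst => [c|f _ x]; first exact: pdeg_cst.
  by congr f; apply/matrixP => -[].
elim: k => [|k IHk].
  rewrite addn0 binn; apply: dimis_cst => [c|f pf]; first exact: pdeg_cst.
  (* The degree becomes a variable constrained to be 0, which keeps induction on [pdeg] possible. *)
  have {pf} : exists2 k, k = 0%N & pdeg k f by exists 0%N.
  move=> [k k0 pf]; elim: pf k0 => //= k' f1 f2 _ e1 _ e2 k0 x.
  by rewrite e1 ?e2.
rewrite addSn binS -{1}addSnnS.
apply: dimis_ext (dimis_trace (lin_subspace_pdeg m k.+1) (fun _ => id) IHk (IHm k.+1)).
by move=> f; split=> [[]//|pf]; split=> //; exact: pdeg_hyper.
Qed.

(** Expansion into unit matrices makes each entry of the image a fixed linear combination of the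
    entries of [W]. *)
Lemma pdeg_linear_mx m p q p' q' k (S : 'M[R]_(p, q) -> 'M[R]_(p', q'))
    (W : 'cV[R]_m -> 'M[R]_(p, q)) :
  linear S -> (forall j i, pdeg k (fun x => W x j i)) ->
  forall a b, pdeg k (fun x => S (W x) a b).
Proof.
move=> lS pW a b.
have -> : (fun x => S (W x) a b) =
    (fun x => \sum_(u : 'I_p * 'I_q) S (delta_mx u.1 u.2) a b * W x u.1 u.2).
  apply/funext => x; rewrite {1}(matrix_sum_delta (W x)).
  rewrite (pair_bigA _ (fun j i => W x j i *: delta_mx j i)) /=.
  rewrite (linear_combination _ _ lS) summxE; apply: eq_bigr => u _.
  by rewrite mxE mulrC.
by apply: pdeg_sum => u _; exact: pdegZ.
Qed.

Lemma dimis_poly_mx m p k :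
  dimis (fun f : 'cV[R]_m -> 'M[R]_(p, 1) => poly_mx k f) (p * 'C(m + k, m)).
Proof.
pose phi (g : 'I_p -> 'cV[R]_m -> R^o) (x : 'cV[R]_m) : 'cV[R]_p := \col_i g i x.
have := @dimis_family _ _ _ _ 'I_p (lin_subspace_pdeg m k) (dimis_pdeg m k).
rewrite card_ord; apply: (@dimis_iso _ _ _ _ _ phi).
- by move=> a g h; apply/funext => x; apply/matrixP => i j; rewrite !fctE !mxE.
- split=> [i|a g h pg ph i]; first exact: pdeg_cst.
  exact: pdeg_linear.
- move=> g pg a b; apply/poly_funP.
  have -> : (fun x => phi g x a b) = g a by apply/funext => x; rewrite mxE.
  exact: pg.
- move=> g _ g0; apply/funext => i; apply/funext => x.
  by have := congr1 (fun h : 'cV[R]_m -> 'cV[R]_p => h x i ord0) g0; rewrite !mxE.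
- move=> f pf; exists (fun i x => f x i ord0).
    by move=> i; exact/poly_funP/pf.
  by apply/funext => x; apply/matrixP => i j; rewrite mxE ord1.
Qed.

End PolynomialSpaces.

(** * Dimensions of Sigma_k and B_k *)

Section StressSpaces.
Variables (R : realType) (m : nat) (v : 'I_m.+2 -> 'cV[R]_m.+1).
Hypothesis nd : nondegen_simplex v.

(* S = P^(k-1) gives Sigma_k and S = 0 gives B_k. *)
Definition stress (k : nat) (S : ('cV[R]_m -> R^o) -> Prop)
    (tau : 'cV[R]_m.+1 -> 'M[R]_m.+1) : Prop :=
  [/\ poly_mx k tau, forall x, \tr (tau x) = 0 &
      forall j i, S (fun s => shear v j (tau (phiF v j s)) i ord0)].

Definition facet_chart_inv (j : 'I_m.+2) (y : 'cV[R]_m.+1) : 'cV[R]_m.+1 :=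
  - (invmx (facet_frame v j) *m v (lift j ord0)) + invmx (facet_frame v j) *m y.

Lemma facet_chartK j : cancel (facet_chart v j) (facet_chart_inv j).
Proof.
move=> x; rewrite /facet_chart_inv /facet_chart mulmxDr addKr mulKmx //.
exact: facet_frame_unit.
Qed.

Lemma facet_chart_invK j : cancel (facet_chart_inv j) (facet_chart v j).
Proof.
move=> y; rewrite /facet_chart_inv /facet_chart mulmxDr mulmxN.
by rewrite !mulKVmx ?facet_frame_unit // addNKr.
Qed.

Lemma pdeg_shear p k j (A : 'cV[R]_p -> 'M[R]_m.+1) :
  (forall a b, pdeg k (fun x => A x a b)) ->
  forall i, pdeg k (fun x => shear v j (A x) i ord0).
Proof.
by move=> pA i; apply: pdeg_linear_mx pA _ _ => c B C; rewrite shear_linear.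
Qed.

(** Each pair of a facet and one of its edges carries an independent scalar component. In the chart
    of its own facet that component ranges over the space counted by [dimis_trace], and [shear_surj]
    recombines arbitrary components. *)
Lemma dimis_stress k (S : ('cV[R]_m -> R^o) -> Prop) N :
  lin_subspace S -> (forall f, S f -> pdeg k.+1 f) -> dimis S N ->
  dimis (stress k.+1 S) (m.+2 * m * ('C(m.+1 + k, m.+1) + N)).
Proof.
move=> sS Sp dS; have dW := dimis_trace sS Sp (dimis_pdeg R m.+1 k) dS.
have sW : lin_subspace (fun f : 'cV[R]_m.+1 -> R^o => pdeg k.+1 f /\ S (f \o @hyper R m)).
  split; first by split; [exact: pdeg_cst|case: sS].
  by move=> a f g [pf Sf] [pg Sg]; split; [exact: pdeg_linear|exact: sS.2].
have := @dimis_family _ _ _ _ ('I_m.+2 * 'I_m)%type sW dW.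
rewrite card_prod !card_ord.
have [D [lD trD sD]] := shear_surj nd.
(* Component [(j, i)] is given in the chart of facet [j], so different inverse charts bring the
   components to the common point [y]. *)
pose comp (g : 'I_m.+2 * 'I_m -> 'cV[R]_m.+1 -> R^o) y : 'M[R]_(m.+2, m) :=
  \matrix_(j, i) g (j, i) (facet_chart_inv j y).
pose phi g y : 'M[R]_m.+1 := D (comp g y).
have shear_phi g j i x : shear v j (phi g (facet_chart v j x)) i ord0 = g (j, i) x.
  by rewrite sD mxE facet_chartK.
apply: (@dimis_iso _ _ _ _ _ phi).
- move=> a g h; apply/funext => y; rewrite !fctE /phi -lD; congr D.
  by apply/matrixP => j i; rewrite !mxE.
- by split=> [u|a g h Wg Wh u]; [exact: sW.1|exact: sW.2].
- move=> g Wg; split=> [a b|x|j i]; last first.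
  + have -> : (fun s => shear v j (phi g (phiF v j s)) i ord0) = g (j, i) \o @hyper R m.
      by apply/funext => s; rewrite -facet_chart_hyper shear_phi.
    by case: (Wg (j, i)).
  + exact: trD.
  + apply/poly_funP; apply: (pdeg_linear_mx (W := comp g)) lD _ _ _ => j i.
    have -> : (fun y => comp g y j i) = (fun y => g (j, i) (facet_chart_inv j y)).
      by apply/funext => y; rewrite mxE.
    by apply: pdeg_affine; case: (Wg (j, i)).
- move=> g _ g0; apply/funext => -[j i]; apply/funext => x.
  by rewrite -shear_phi g0 /shear mulmx0 mul0mx mxE.
- move=> tau [ptau trtau Stau].
  exists (fun u x => shear v u.1 (tau (facet_chart v u.1 x)) u.2 ord0).
    move=> [j i]; split=> /=.
      apply: pdeg_shear => a b.
      apply: (@pdeg_affine _ _ _ _ (fun x => tau x a b)).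
      exact/poly_funP/ptau.
    have -> : (fun x => shear v j (tau (facet_chart v j x)) i ord0) \o @hyper R m =
      (fun s => shear v j (tau (phiF v j s)) i ord0).
      by apply/funext => s /=; rewrite facet_chart_hyper.
    exact: Stau.
  (* Both fields are trace-free with equal shears at every point. *)
  apply/funext => y; apply/subr0_eq/(shear_inj nd).
    by rewrite linearB /= trtau trD subrr.
  move=> j; rewrite shearB; apply/eqP; rewrite subr_eq0; apply/eqP/colP => i.
  by rewrite sD [RHS]mxE /= facet_chart_invK.
Qed.

(** On each facet [shear] and [tnt] are linear images of one another, so the degree bound passes
    both ways. *)
Lemma SigmaP k tau : Sigma k.+1 v tau <-> stress k.+1 (fun f => pdeg k f) tau.
Proof.
split=> -[ptau tr0 ptr]; split=> // j.
  move=> i; have [n un] := unit_normal_exists nd j.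
  have [c c0 cE] := jacF_tnt nd un.
  have -> : (fun s => shear v j (tau (phiF v j s)) i ord0) =
      (fun s => (c^-1 *: ((jacF v j)^T *m tnt n (tau (phiF v j s)))) i ord0).
    by apply/funext => s; rewrite cE scalerA mulVf // scale1r.
  apply: (@pdeg_linear_mx _ _ _ _ _ _ _ (fun A => c^-1 *: ((jacF v j)^T *m A))).
    by move=> a A B; rewrite mulmxDr scalerDr -scalemxAr !scalerA mulrC.
  by move=> a b; apply/poly_funP/ptr.
move=> n un a b; have [Q QE] := tnt_shear nd un; apply/poly_funP.
have -> : (fun s => tnt n (tau (phiF v j s)) a b) =
    (fun s => (Q *m shear v j (tau (phiF v j s))) a b).
  by apply/funext => s; rewrite QE.
apply: (@pdeg_linear_mx _ _ _ _ _ _ _ (mulmx Q)).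
  by move=> e A B; rewrite linearP.
by move=> i i'; rewrite ord1.
Qed.

(** [Bk] asks for vanishing on the facet, [stress] on its whole hyperplane; a polynomial that
    vanishes on a simplex vanishes everywhere. *)
Lemma BkP k tau : Bk k.+1 v tau <-> stress k.+1 (fun f => f = 0) tau.
Proof.
split=> [[/SigmaP[ptau tr0 ptr] b0]|[ptau tr0 s0]].
  split=> // j i; apply/funext => s; apply: (pdeg_eq0_simplex (ptr j i)) => y y0 y1.
  have [n un] := unit_normal_exists nd j; have [c c0 cE] := jacF_tnt nd un.
  rewrite -[shear _ _ _]scale1r -(mulVf c0) -scalerA -cE b0 //.
    by rewrite mulmx0 scaler0 mxE.
  by split=> //; exact: ltW.
have s0' j s : shear v j (tau (phiF v j s)) = 0.
  by apply/colP => i; rewrite [RHS]mxE; exact: (congr1 (fun f : 'cV[R]_m -> R^o => f s) (s0 j i)).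
split; first by apply/SigmaP; split=> // j i; rewrite s0; exact: pdeg_cst.
move=> j n un s _; have [Q ->] := tnt_shear nd un.
by rewrite s0' mulmx0.
Qed.

Lemma dimis_Sigma k :
  dimis (Sigma k.+1 v) (m.+2 * m * ('C(m.+1 + k, m.+1) + 'C(m + k, m))).
Proof.
apply: (dimis_ext (fun tau => iff_sym (SigmaP k tau))).
apply: dimis_stress (dimis_pdeg R m k); first exact: lin_subspace_pdeg.
by move=> f; exact: pdegS.
Qed.

Lemma dimis_Bk k : dimis (Bk k.+1 v) (m.+2 * m * 'C(m.+1 + k, m.+1)).
Proof.
apply: (dimis_ext (fun tau => iff_sym (BkP k tau))).
rewrite -[X in (_ * X)%N]addn0; apply: dimis_stress (dimis0 _).
  by split=> // a f g -> ->; rewrite scaler0 addr0.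
by move=> f ->; exact: pdeg_cst.
Qed.

End StressSpaces.

(** * Transport from the reference simplex and unisolvence *)

Section Unisolvence.
Variables (R : realType) (m : nat) (v : 'I_m.+2 -> 'cV[R]_m.+1).
Hypothesis nd : nondegen_simplex v.

Lemma jacT_ref : jacT (@ref_vert R m.+1) = 1%:M.
Proof.
apply/matrixP => a i; rewrite !mxE /= subr0 /bump /= add1n eqSS eq_sym.
by rewrite -val_eqE; case: eqP.
Qed.

Lemma phiT_ref j : phiT v (ref_vert R j) = v j.
Proof.
rewrite /phiT; case: (unliftP ord0 j) => [i ->|->].
  have -> : ref_vert R (lift ord0 i) = delta_mx i ord0.
    apply/matrixP => a b; rewrite !mxE ord1 /= /bump /= add1n eqSS eqxx andbT eq_sym.
    by rewrite -val_eqE; case: eqP.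
  rewrite -colE; apply/matrixP => a b; rewrite !mxE ord1.
  by rewrite addrC subrK.
have -> : ref_vert R (@ord0 m.+1) = 0 by apply/matrixP => a b; rewrite !mxE.
by rewrite mulmx0 addr0.
Qed.

Lemma jacF_ref j : jacF v j = jacT v *m jacF (@ref_vert R m.+1) j.
Proof.
apply/matrixP => a i.
have colE0 (w : 'I_m.+2 -> 'cV[R]_m.+1) :
    col i (jacF w j) = w (lift j (lift ord0 i)) - w (lift j ord0).
  apply/colP => b; rewrite !mxE.
  by rewrite (@fvertE _ _ _ _ _ (lift ord0 i)) // (@fvertE _ _ _ _ _ ord0).
have : col i (jacF v j) = col i (jacT v *m jacF (@ref_vert R m.+1) j).
  rewrite [RHS]colE -mulmxA -colE !colE0 mulmxBr -!phiT_ref /phiT opprD addrACA subrr add0r //.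
by move=> /matrixP/(_ a ord0); rewrite !mxE.
Qed.

Lemma phiT_phiF j s : phiT v (phiF (@ref_vert R m.+1) j s) = phiF v j s.
Proof.
by rewrite !phiF_lift jacF_ref /phiT mulmxDr addrA -[v (lift j ord0)]phiT_ref mulmxA.
Qed.

Lemma frobE n (A B : 'M[R]_n) : frob A B = \tr (A^T *m B).
Proof.
rewrite /frob exchange_big; apply: eq_bigr => j _; rewrite !mxE.
by apply: eq_bigr => i _; rewrite mxE.
Qed.

Lemma frob_ge0 n (A : 'M[R]_n) : 0 <= frob A A.
Proof. by apply: sumr_ge0 => i _; apply: sumr_ge0 => j _; rewrite -expr2 sqr_ge0. Qed.

Lemma frob_eq0 n (A : 'M[R]_n) : frob A A = 0 -> A = 0.
Proof.
move=> A0; apply/matrixP => i j; rewrite mxE.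
have := dotv_eq0 (a := (row i A)^T) _ => /(_ _)/colP/(_ j).
rewrite !mxE; apply; apply/eqP; move/eqP: A0; rewrite psumr_eq0; last first.
  by move=> k _; apply: sumr_ge0 => l _; rewrite -expr2 sqr_ge0.
move=> /allP/(_ i (mem_index_enum i)) /= /eqP <-; apply/eqP.
by apply: eq_bigr => k _; rewrite !mxE.
Qed.

Lemma pdeg_frob p n k (A : 'cV[R]_p -> 'M[R]_n) :
  (forall a b, pdeg k (fun x => A x a b)) -> pdeg (k + k) (fun x => frob (A x) (A x)).
Proof. by move=> pA; apply: pdeg_sum => i _; apply: pdeg_sum => j _; exact: pdegM. Qed.

Lemma pdeg_dotv p n k (A : 'cV[R]_p -> 'cV[R]_n) :
  (forall a, pdeg k (fun x => A x a ord0)) -> pdeg (k + k) (fun x => dotv (A x) (A x)).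
Proof. by move=> pA; apply: pdeg_sum => i _; exact: pdegM. Qed.

(** For the test coordinates J^T tau_nt, which have admissible degree, the integrand is |J^T
    tau_nt|^2, and J^T tau_nt is a nonzero multiple of the shear. *)
Lemma facet_dofs_eq0 k tau : Sigma k.+1 v tau ->
  (forall j n rh, unit_normal v j n -> poly_mx k rh -> dof_F v j n rh tau = 0) ->
  forall j s, shear v j (tau (phiF v j s)) = 0.
Proof.
move=> [ptau tr0 ptr] dof0 j; have [n un] := unit_normal_exists nd j.
pose J := jacF v j; pose rh s := J^T *m tnt n (tau (phiF v j s)).
have prh a b : pdeg k (fun s => rh s a b).
  apply: (@pdeg_linear_mx _ _ _ _ _ _ _ (mulmx J^T)).
    by move=> e A B; rewrite linearP.
  by move=> c e; apply/poly_funP/(ptr j n un).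
have /eqP : dof_F v j n rh tau = 0 by apply: dof0 => // a b; exact/poly_funP.
(* The Gram factor is positive, so the integral itself vanishes. *)
rewrite mulf_eq0 sqrtr_eq0 leNgt gram_gt0 //= => /eqP int0.
have rh0 s : rh s = 0.
  apply: dotv_eq0; apply: (simplex_int_pdeg_eq0 (pdeg_dotv (fun a => prh a ord0))).
    by move=> y; exact: dotv_ge0.
  rewrite -[RHS]int0; congr simplex_int; apply/funext => y.
  by rewrite [RHS]dotvE mulmxA dotvE {1}/rh trmx_mul trmxK.
move=> s; have [c c0 cE] := jacF_tnt nd un.
by rewrite -[shear _ _ _]scale1r -(mulVf c0) -scalerA -cE -/J -/(rh s) rh0 scaler0.
Qed.

Lemma interior_dofs_eq0 k tau : Sigma k.+1 v tau ->
  (forall j s, shear v j (tau (phiF v j s)) = 0) ->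
  (forall eta, Bk k.+1 (@ref_vert R m.+1) eta -> dof_T v eta tau = 0) ->
  forall x, tau x = 0.
Proof.
move=> [ptau tr0 _] s0 dof0; pose F := jacT v.
have Fu : F \in unitmx by exact: nd.
have ndr : nondegen_simplex (@ref_vert R m.+1) by rewrite /nondegen_simplex jacT_ref unitmx1.
(* This transformation preserves [t^T tau n] and is dual to the one in [dof_T]. *)
pose eta xh := F^T *m tau (phiT v xh) *m invmx F^T.
have peta a b : pdeg k.+1 (fun x => eta x a b).
  apply: (@pdeg_linear_mx _ _ _ _ _ _ _ (fun A => F^T *m A *m invmx F^T)).
    by move=> c A B; rewrite mulmxDr mulmxDl -scalemxAr -scalemxAl.
  move=> i j; apply: (@pdeg_affine _ _ _ _ (fun x => tau x i j)).
  exact/poly_funP/ptau.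
have Beta : Bk k.+1 (@ref_vert R m.+1) eta.
  apply/BkP => //; split=> [a b|x|j i]; first exact/poly_funP.
    by rewrite mxtrace_mulC mulmxA mulVmx ?unitmx_tr // mul1mx.
  apply/funext => s.
  (* The inverse transposed Jacobian carries a reference gradient to a multiple of the actual one,
     and [F] carries reference edges to actual edges; the shears of [eta] are thus multiples of
     those of [tau], which vanish. *)
  have [c cE] : exists c, invmx F^T *m bary_grad (@ref_vert R m.+1) j = c *: bary_grad v j.
    apply: (perp_bary_grad nd); rewrite jacF_ref trmx_mul -mulmxA mulKVmx ?unitmx_tr //.
    exact: jacF_bary_grad.
  rewrite /shear -!mulmxA cE phiT_phiF !mulmxA -trmx_mul -jacF_ref.
  by rewrite -scalemxAr -/(shear v j _) s0 scaler0 mxE.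
have /eqP := dof0 _ Beta; rewrite mulf_eq0 normr_eq0 -[\det _ == 0]negbK -unitfE.
rewrite -unitmxE Fu orFb => /eqP int0.
have eta0 x : eta x = 0.
  apply: frob_eq0; apply: (simplex_int_pdeg_eq0 (pdeg_frob peta)).
    by move=> y; exact: frob_ge0.
  rewrite -[RHS]int0; congr (@simplex_int R m.+1 1 _); apply/funext => y.
  have -> : invmx F *m (phiT v y - v ord0) = y.
    by rewrite /phiT addrC addKr mulKmx.
  (* Since eta^T = F^(-1) tau^T F, cyclicity of the trace turns tau : F eta F^(-1) into eta :
     eta. *)
  rewrite !frobE -/F {1}/eta !trmx_mul trmxK trmx_inv trmxK -!mulmxA.
  by rewrite mxtrace_mulC -!mulmxA.
move=> x; have := eta0 (invmx F *m (x - v ord0)); rewrite /eta.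
have -> : phiT v (invmx F *m (x - v ord0)) = x by rewrite /phiT mulKVmx // addrC subrK.
move=> /(congr1 (fun A => invmx F^T *m (A *m F^T))).
by rewrite mulmxKV ?unitmx_tr // mulKmx ?unitmx_tr // mul0mx mulmx0.
Qed.

Lemma stress_element_unisolvent k :
  [/\ (forall tau : 'cV[R]_m.+1 -> 'M[R]_m.+1,
         Sigma k.+1 v tau ->
         (forall j n rh, unit_normal v j n -> poly_mx k rh -> dof_F v j n rh tau = 0) ->
         (forall eta, Bk k.+1 (@ref_vert R m.+1) eta -> dof_T v eta tau = 0) ->
         forall x, tau x = 0),
      has_dim (@poly_mx R m m 1 k) (m * 'C(m + k, m)),
      has_dim (Bk k.+1 (@ref_vert R m.+1)) (m.+2 * m * 'C(m.+1 + k, m.+1)) &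
      has_dim (Sigma k.+1 v) (m.+2 * m * ('C(m.+1 + k, m.+1) + 'C(m + k, m)))].
Proof.
split.
- by move=> tau Stau dF; apply: interior_dofs_eq0 => //; exact: facet_dofs_eq0 dF.
- exact/has_dim_dimis/dimis_poly_mx.
- by apply/has_dim_dimis/dimis_Bk; rewrite /nondegen_simplex jacT_ref unitmx1.
- exact/has_dim_dimis/dimis_Sigma.
Qed.

End Unisolvence.

(** * Binomial arithmetic and the finite element *)

Lemma bin2_mul k : ('C(2 + k, 2) * 2 = (k + 2) * (k + 1))%N.
Proof. by have := mul_bin_diag (2 + k) 1; rewrite bin1; lia. Qed.

Lemma bin3_mul k : ('C(3 + k, 3) * 6 = (k + 3) * (k + 2) * (k + 1))%N.
Proof.
have := mul_bin_diag (3 + k) 2; have := bin2_mul k; rewrite -[(3 + k).-1]/(2 + k)%N; nia.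
Qed.

Theorem theorem5p4 (R : realType) (d k : nat) (v : 'I_d.+1 -> 'cV[R]_d) :
  (d = 2%N \/ d = 3%N) -> (1 <= k)%N -> nondegen_simplex v ->
  [/\
    (* unisolvence: vanishing of all degrees of freedom forces tau = 0 *)
    (forall tau : 'cV[R]_d -> 'M[R]_d,
       Sigma k v tau ->
       (forall (j : 'I_d.+1) (n : 'cV[R]_d) (rh : 'cV[R]_d.-1 -> 'cV[R]_d.-1),
          unit_normal v j n -> poly_mx k.-1 rh -> dof_F v j n rh tau = 0) ->
       (forall etah : 'cV[R]_d -> 'M[R]_d,
          Bk k (@ref_vert R d) etah -> dof_T v etah tau = 0) ->
       forall x, tau x = 0),
    (* number of functionals = dim Sigma_k(T) *)
    (exists NP NB NS : nat,
       [/\ has_dim (@poly_mx R d.-1 d.-1 1 k.-1) NP,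
           has_dim (Bk k (@ref_vert R d)) NB,
           has_dim (Sigma k v) NS &
           NS = (d.+1 * NP + NB)%N]) &
    (* dimension formula *)
    has_dim (Sigma k v)
      (if d == 2%N then ((3 * (k.+1 * k.+2)) %/ 2 - 3)%N
       else ((8 * (k.+1 * k.+2 * k.+3)) %/ 6 - 8 * k.+1)%N)].
Proof.
move=> d23; case: k => // k _.
have [m dE] : exists m, d = m.+1 by case: d23 => ->; eexists.
subst d => nd; have [uni dP dB dS] := stress_element_unisolvent nd k.
split=> //.
  (* The dimension splits into d+1 copies of the facet test space and the interior test space. *)
  do 3!eexists; split; [exact: dP|exact: dB|exact: dS|].
  by rewrite mulnDr addnC mulnA.
suff -> : (if m.+1 == 2%N then (3 * (k.+2 * k.+3)) %/ 2 - 3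
       else (8 * (k.+2 * k.+3 * k.+4)) %/ 6 - 8 * k.+2)%N =
    (m.+2 * m * ('C(m.+1 + k, m.+1) + 'C(m + k, m)))%N by [].
case: d23 => -[->] /=.
  rewrite bin1; have b2 := bin2_mul k.
  (* Half of (k+2)(k+3) is C(k+3,2), expanded by Pascal's rule; as an explicit multiple of 2 the
     numerator makes the truncated division exact. Here [k] is the polynomial degree minus one. *)
  have -> : (3 * (k.+2 * k.+3) = (3 * ('C(2 + k, 2) + k + 2)) * 2)%N by nia.
  by rewrite mulnK //; lia.
have b2 := bin2_mul k; have b3 := bin3_mul k.
(* One sixth of the product is C(k+4,3), expanded by applying Pascal's rule twice. *)
have -> : (8 * (k.+2 * k.+3 * k.+4) = (8 * ('C(3 + k, 3) + 'C(2 + k, 2) + k + 2)) * 6)%N by nia.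
by rewrite mulnK //; lia.
Qed.
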